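(* For every prime $p\equiv 5\pmod 8$ with $p\geq 13$, let $\Gamma_p$ be the digraph with adjacency matrix $$A_p=\begin{pmatrix} B_p & B_p^{\mathsf T}\\ B_p & B_p^{\mathsf T}\end{pmatrix},$$ where $B_p$ is the adjacency matrix of the Szekeres tournament $S_p$. Then $\Gamma_p$ is an intransitive directed strongly regular graph with parameters $(v,k,t,\lambda,\mu)=(4p+2,\,2p,\,p,\,p-1,\,p)$. Its Weisfeiler--Leman closure is a homogeneous noncommutative association scheme of rank six, and this scheme is non-Schurian. Consequently, the graphs $\Gamma_p$ form an infinite family of intransitive directed strongly regular graphs with homogeneous Weisfeiler--Leman closure of the smallest possible noncommutative rank (namely six).
   Context: All graphs, digraphs, groups and configurations are finite. $I$ and $J$ denote the identity matrix and the all-one matrix of the appropriate order. Szekeres tournament $S_p$ ($p\equiv 5 \pmod 8$ prime, $p\ge 13$): let $H_4$ be the subgroup of fourth powers in $\mathbb Z_p^{\times}$; its four cosets are $H_4,2H_4,4H_4,8H_4$. The vertex set is $V(S_p)=(\mathbb Z_p\times\{0,1\})\sqcup\{\infty\}$, and the out-neighbourhoods are, for $a\in\mathbb Z_p$, $$N^+((a,0))=\bigl(a+(H_4\cup 2H_4)\bigr)\times\{0\}\ \cup\ \{(a,1)\}\ \cup\ \bigl(a+(H_4\cup 8H_4)\bigr)\times\{1\},$$ $$N^+((a,1))=\bigl(a+(H_4\cup 8H_4)\bigr)\times\{0\}\ \cup\ \{\infty\}\ \cup\ \bigl(a+(4H_4\cup 8H_4)\bigr)\times\{1\},$$ $$N^+(\infty)=\mathbb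 Z_p\times\{0\}.$$ The adjacency matrix $B$ of a digraph has $B_{xy}=1$ iff $(x,y)$ is an arc (i.e. $y\in N^+(x)$), and $0$ otherwise. A loopless digraph on vertex set $V$ with adjacency matrix $A$ (opposite arcs allowed) is a directed strongly regular graph (DSRG) with parameters $(v,k,t,\lambda,\mu)$ if $|V|=v$, $AJ=JA=kJ$ and $A^2=tI+\lambda A+\mu(J-I-A)$. It is proper if $0<t<k$. $\operatorname{Aut}(\Gamma)$ is the group of permutations of $V$ preserving the arc set; $\Gamma$ is intransitive if $\operatorname{Aut}(\Gamma)$ is not transitive on $V$. A coherent configuration on a finite set $\Omega$ is a partition $\mathcal R=\{R_0,\dots,R_{r-1}\}$ of $\Omega\times\Omega$ such that: (1) the diagonal $1_\Omega$ is a union of members of $\mathcal R$; (2) the transpose of each $R_i$ is in $\mathcal R$; (3) for all $i,j,k$ there is a nonnegative integer $p_{ij}^k$ such that for every $(x,y)\in R_k$, $|\{z\in\Omega:(x,z)\in R_i,(z,y)\in R_j\}|=p_{ij}^k$. The $R_i$ are the basis relations and $r$ is the rank. Its adjacency algebra is the complex span of the adjacency matrices of the $R_i$. It is homogeneous if $1_\Omega$ is itself a basis relation; an association scheme means a homogeneous coherent configuration; it is noncommutative if its adjacency algebra is not commutative. A coherent configuration is Schurian if its basis relations are exactly the orbits on $\Omega\times\Omega$ (under the componentwise action) of some permutation group $G\le \operatorname{Sym}(\Omega)$, and non-Schurian otherwise. The Weisfeiler--Leman closure of a digraph $\Gamma$ on $V$ is the smallest (i.e. coarsest) coherent configuration on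 $V$ whose adjacency algebra contains the adjacency matrix of $\Gamma$; equivalently, the smallest one in which the arc relation of $\Gamma$ is a union of basis relations. ''Smallest possible noncommutative rank'' refers to the known fact that if a proper DSRG has arc relation equal to a nontrivial union of basis relations of an association scheme, then that association scheme is noncommutative and has rank at least six. *)

(* Defs.v *)
From mathcomp Require Import all_boot all_order all_algebra all_fingroup.
From mathcomp Require Import reals.
From mathcomp Require Export complex.

Set Implicit Arguments.
Unset Strict Implicit.
Unset Printing Implicit Defensive.

Import GRing.Theory.
Local Open Scope ring_scope.

(* A digraph on V is its arc relation; since matrices are indexed by
   ordinals, V is listed in the order of [enum V]. *)
Definition adjmx (K : pzRingType) (V : finType) (e : rel V) : 'M[K]_#|V| :=
  \matrix_(i, j) (e (enum_val i) (enum_val j))%:R.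

Section Digraphs.

Variable V : finType.
Implicit Type e : rel V.

Definition is_dsrg e (v k t lam mu : nat) : Prop :=
  let A := adjmx int e in
  let J := const_mx 1 : 'M[int]_#|V| in
  [/\ irreflexive e,
      #|V| = v,
      A *m J = k%:R *: J /\ J *m A = k%:R *: J
    & A *m A = t%:R%:M + lam%:R *: A + mu%:R *: (J - 1%:M - A)].

Definition is_proper_dsrg e (v k t lam mu : nat) : Prop :=
  is_dsrg e v k t lam mu /\ (0 < t < k)%N.

Definition digraph_aut e : {set {perm V}} :=
  [set g : {perm V} | [forall x, forall y, e (g x) (g y) == e x y]].

Lemma digraph_aut_group_set e : group_set (digraph_aut e).
Proof.
apply/group_setP; split=> [|g h].
  by rewrite inE; apply/forallP=> x; apply/forallP=> y; rewrite !perm1.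
rewrite !inE => /forallP gP /forallP hP.
apply/forallP=> x; apply/forallP=> y; rewrite !permM.
by rewrite (eqP (forallP (hP _) _)) (eqP (forallP (gP _) _)).
Qed.
Canonical digraph_aut_group e := Group (digraph_aut_group_set e).

Definition intransitive e : Prop :=
  ~ [transitive digraph_aut e, on [set: V] | 'P].

End Digraphs.

Definition digraph_isomorphic (V W : finType) (e : rel V) (f : rel W) : Prop :=
  exists2 h : V -> W, bijective h & forall x y, f (h x) (h y) = e x y.

Section Configurations.

Variable V : finType.
Implicit Types (r s : {set V * V}) (X Y : {set {set V * V}}).

Definition diagonal : {set V * V} := [set xy | xy.1 == xy.2].
Definition converse r : {set V * V} := [set xy | (xy.2, xy.1) \in r].
Definition rel_of_set r : rel V := fun x y => (x, y) \in r.
Definition arcs (e : rel V) : {set V * V} := [set xy | e xy.1 xy.2].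

(* A configuration is given by its set X of basis relations; its rank
   is #|X|. *)
Definition is_coherent X : Prop :=
  [/\ partition X [set: V * V],
      (exists2 D : {set {set V * V}}, D \subset X & diagonal = cover D),
      (forall r, r \in X -> converse r \in X)
    & forall ri rj rk, ri \in X -> rj \in X -> rk \in X ->
      exists m : nat, forall x y, (x, y) \in rk ->
        #|[set z | ((x, z) \in ri) && ((z, y) \in rj)]| = m].

Definition homogeneous X : Prop := diagonal \in X.

Definition is_association_scheme X : Prop := is_coherent X /\ homogeneous X.

Definition adjacency_algebra (R : realType) X : {vspace 'M[R[i]]_#|V|} :=
  <<[seq adjmx R[i] (rel_of_set r) | r <- enum X]>>%VS.

Definition noncommutative (R : realType) X : Prop :=
  ~ {in adjacency_algebra R X &, forall M N, M *m N = N *m M}.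

Definition is_schurian X : Prop :=
  exists G : {group {perm V}},
    X = [set [set ((g : {perm V}) xy.1, (g : {perm V}) xy.2) | g in G]
         | xy : V * V].

(* X is coarser than (a fusion of) Y, for partitions X and Y of V * V *)
Definition coarser X Y : Prop :=
  forall s, s \in Y -> exists2 r, r \in X & s \subset r.

Definition is_WL_closure (R : realType) (e : rel V) X : Prop :=
  [/\ is_coherent X,
      adjmx R[i] e \in adjacency_algebra R X
    & forall Y, is_coherent Y -> adjmx R[i] e \in adjacency_algebra R Y ->
      coarser X Y].

Lemma is_WL_closure_unique R e X Y :
  is_WL_closure R e X -> is_WL_closure R e Y -> X = Y.
Proof.
suff sub Z T : is_WL_closure R e Z -> is_WL_closure R e T -> Z \subset T.
  by move=> wX wY; apply/eqP; rewrite eqEsubset !sub.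
move=> [cohZ eZ minZ] [cohT eT minT]; apply/subsetP=> r rZ.
have [/and3P[_ tZ Z0] _ _ _] := cohZ.
have [s sT rs] := minT _ cohZ eZ _ rZ.
have [r' r'Z sr'] := minZ _ cohT eT _ sT.
have r0 : r != set0 by apply: contraNneq Z0 => <-.
have [xy xyr] := set0Pn _ r0.
have err' : r = r'.
  rewrite -(def_pblock tZ rZ xyr); apply: def_pblock => //.
  by rewrite (subsetP sr') // (subsetP rs).
by rewrite (_ : r = s) //; apply/eqP; rewrite eqEsubset rs err' sr'.
Qed.

End Configurations.

Definition szekeres_prime (p : nat) : Prop :=
  [/\ prime p, p %% 8 = 5 & 13 <= p]%N.

Section Szekeres.

Variable p : nat.

Definition coset_H4 (c : 'F_p) : {set 'F_p} :=
  [set c * x ^+ 4 | x : 'F_p & x != 0].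

(* [Some (a, false)], [Some (a, true)] and [None] are the vertices written
   (a, 0), (a, 1) and infinity. *)
Definition szekeres_vertex : finType := option ('F_p * bool).

Definition layer (b : bool) (a : 'F_p) (D : {set 'F_p}) :
    {set szekeres_vertex} :=
  [set Some (a + d, b) | d in D].

Definition szekeres_out (u : szekeres_vertex) : {set szekeres_vertex} :=
  match u with
  | Some (a, false) =>
      layer false a (coset_H4 1 :|: coset_H4 2%:R)
      :|: [set Some (a, true)]
      :|: layer true a (coset_H4 1 :|: coset_H4 8%:R)
  | Some (a, true) =>
      layer false a (coset_H4 1 :|: coset_H4 8%:R)
      :|: [set None]
      :|: layer true a (coset_H4 4%:R :|: coset_H4 8%:R)
  | None => [set Some (a, false) | a : 'F_p]
  end.

Definition szekeres : rel szekeres_vertex := fun u w => w \in szekeres_out u.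

(* The two blocks of rows and columns of the adjacency matrix are the two
   summands; see [GammaE]. *)
Definition Gamma_vertex : finType := (szekeres_vertex + szekeres_vertex)%type.

Definition Gamma : rel Gamma_vertex := fun x y =>
  let u := match x with inl u | inr u => u end in
  match y with
  | inl w => szekeres u w
  | inr w => szekeres w u
  end.

Definition Gamma_of_ord
    (i : 'I_(#|szekeres_vertex| + #|szekeres_vertex|)) : Gamma_vertex :=
  match split i with
  | inl a => inl (enum_val a)
  | inr a => inr (enum_val a)
  end.

Lemma Gamma_of_ord_bij : bijective Gamma_of_ord.
Proof.
exists (fun x : Gamma_vertex => match x with
  | inl u => lshift _ (enum_rank u) | inr u => rshift _ (enum_rank u) end).
  move=> i; rewrite /Gamma_of_ord -{2}(splitK i).
  by case: (split i) => a /=; rewrite enum_valK.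
case=> u; rewrite /Gamma_of_ord.
  by rewrite (unsplitK (inl _)) enum_rankK.
by rewrite (unsplitK (inr _)) enum_rankK.
Qed.

Lemma GammaE (K : pzRingType) :
  let B := adjmx K szekeres in
  \matrix_(i, j) (Gamma (Gamma_of_ord i) (Gamma_of_ord j))%:R =
  block_mx B B^T B B^T.
Proof.
apply/matrixP=> i j; rewrite !mxE /Gamma_of_ord.
by case: (split i) => a; rewrite !mxE; case: (split j) => b; rewrite !mxE.
Qed.

End Szekeres.

Arguments szekeres p : clear implicits.
Arguments Gamma p : clear implicits.

(* Main.v *)
Require Import Defs.
From mathcomp Require Import all_boot all_order all_algebra all_fingroup.
From mathcomp Require Import reals.
From mathcomp Require Import finfield zify ring lra.

(* Let [s] be the skew sign matrix of [S_p] and [chi] the quartic character with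
   [chi 2 = i]; every entry of [s] between two layers is Re chi + Im chi or
   Re chi - Im chi, up to sign, so that products of rows and the triple products
   [T u x y = sum_v s u v * s x v * s y v] reduce to Jacobi sums.  With
   [J(chi, chi) = alpha + i beta], where [alpha ^ 2 + beta ^ 2 = p]:
   distinct rows of [s] have product -1, which gives the scheme and the parameters;
   [T infty (0,0) (z,0) = +- 2 beta], [T infty (0,0) (0,1) = 0], and
   [T infty (0,0) (z,1)] vanishes for some [z <> 0] only if [alpha = +- 1];
   [T (0,0) (0,1) (z,0)] is [2 - 2 alpha] or [2 beta] as [z] is in [2 H_4] or [H_4].
   If [Aut S_p] were transitive, some automorphism would map the arc
   [infty -> (0,0)] to [(0,0) -> (0,1)] (compose with a translation).  Comparing [T]
   gives [1 - alpha = +- beta], hence [alpha <> +- 1] as [p >= 13], so that the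
   automorphism rotates the triangle [infty, (0,0), (0,1)].  It then preserves
   [H_4 x 0], the common out-neighbours of the triangle, on which [T] gives
   [-2 beta = 2 beta], a contradiction.

   For a proper DSRG with matrix [A], let [K = A - A^T].  If [A] is normal then either
   [K = 0] and [t = k], or [K ^ 3 = delta K] with [delta < 0], which forces
   [A + A^T = J - I] and [t = 0].  For the rank, let [U = 2 A - (lam - mu) I - c J] with
   [c] such that [U J = 0]; then [U ^ 2 = delta P] with [P = I - J / n], and the
   commutator [C] of [U] and [U^T] is a nonzero symmetric matrix anticommuting with
   both.  Hence [P, U, U^T, C, J, C ^ 2] are linearly independent as soon as
   [tr U <> 0]; and [tr U = 0] would make [k] divide [t]. *)

Set Implicit Arguments.
Unset Strict Implicit.
Unset Printing Implicit Defensive.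

Import Order.TTheory GRing.Theory Num.Theory.
Local Open Scope ring_scope.

(** * Sums of a quartic character *)

Section QuarticCharacter.

Variable p : nat.
Hypotheses (p_pr : prime p) (p_mod8 : (p %% 8 = 5)%N).
Implicit Types x y z w d : 'F_p.

Local Notation m := (p %/ 4)%N.

(** The quartic character with values in ['F_p]; here [m] is (p - 1) / 4 and [qi] plays the part of
    i. [re_val] and [im_val] read the fourth roots of unity 1, -1, [qi], [- qi] as the integer
    coordinates of 1, -1, i, -i, and send 0 to 0. *)
Definition qchi x : 'F_p := x ^+ m.
Definition qi : 'F_p := qchi 2%:R.
Definition re_val x : int := (x == 1)%:R - (x == -1)%:R.
Definition im_val x : int := (x == qi)%:R - (x == - qi)%:R.
Definition qre x : int := re_val (qchi x).
Definition qim x : int := im_val (qchi x).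
(** The real part of chi ^ 2, that is, the Legendre symbol. *)
Definition qrho x : int := qre x ^+ 2 - qim x ^+ 2.

Lemma quarter_eq : p = (4 * m + 1)%N. Proof. lia. Qed.
Lemma odd_quarter : odd m. Proof. lia. Qed.
Lemma quarter_gt0 : (0 < m)%N. Proof. lia. Qed.

Lemma two_neq0 : 2%:R != 0 :> 'F_p.
Proof.
rewrite -(dvdn_pcharf (pchar_Fp p_pr)).
apply/negP => /dvdn_leq; have := prime_gt1 p_pr; lia.
Qed.

Lemma expf_p1 x : x != 0 -> x ^+ (4 * m) = 1.
Proof.
move=> x0; apply: (mulfI x0); rewrite mulr1 -exprS -[RHS]expf_card card_Fp //.
by congr (_ ^+ _); have := quarter_eq; lia.
Qed.

Lemma neq_opp x : x != 0 -> (x == - x) = false.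
Proof.
by move=> x0; rewrite -subr_eq0 opprK -mulr2n -mulr_natl mulf_eq0 (negPf x0) (negPf two_neq0).
Qed.

(** X ^ (2m) - 1 has at most 2m roots among the 4m units, so some unit has x ^ (2m) = -1; its power
    x ^ m is the root. *)
Lemma exists_sqrtN1 : exists j : 'F_p, j ^+ 2 = -1.
Proof.
have [x x0 xm] : exists2 x : 'F_p, x != 0 & x ^+ (2 * m) != 1.
  apply/exists_inP; rewrite -negb_forall_in; apply/negP => /forall_inP h.
  pose P : {poly 'F_p} := 'X^(2 * m) - 1%:P.
  have sP : size P = (2 * m).+1 by rewrite size_XnsubC //; have := quarter_gt0; lia.
  have P0 : P != 0 by rewrite -size_poly_eq0 sP.
  have := @max_poly_roots _ P (enum (predC1 (0 : 'F_p))) P0.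
  rewrite enum_uniq -cardE sP cardC1 card_Fp //.
  have -> : all (root P) (enum (predC1 (0 : 'F_p))).
    apply/allP => y; rewrite mem_enum inE => y0.
    by rewrite /root !hornerE (eqP (h y y0)) subrr.
  move=> /(_ isT isT); have := quarter_gt0; have := quarter_eq; lia.
exists (x ^+ m); rewrite -exprM mulnC.
have : (x ^+ (2 * m)) ^+ 2 == 1 by rewrite -exprM mulnC mulnA expf_p1.
by rewrite sqrf_eq1 (negPf xm) => /eqP.
Qed.

(** With j ^ 2 = -1 one has (1 + j) ^ 2 = 2 j. Raising this to the power 2m gives 1 = [qi] ^ 2 *
    (-1) ^ m, and m is odd because p = 5 mod 8. *)
Lemma qi_sqr : qi ^+ 2 = -1.
Proof.
have [j j2] := exists_sqrtN1.
have j0 : j != 0 by apply: contra_eq_neq j2 => ->; rewrite expr0n eq_sym oppr_eq0 oner_eq0.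
have h1 : (1 + j) ^+ 2 = 2%:R * j by rewrite sqrrD j2; ring.
have n0 : 1 + j != 0.
  by rewrite -sqrf_eq0 h1 mulf_neq0 // two_neq0.
have : (1 + j) ^+ (4 * m) = 1 by rewrite expf_p1.
have -> : (4 * m = 2 * (2 * m))%N by lia.
rewrite exprM h1 exprMn [j ^+ _]exprM j2 -[(-1) ^+ _]signr_odd odd_quarter expr1 mulrN1.
by move=> /eqP; rewrite eqr_oppLR /qi /qchi -exprM mulnC => /eqP.
Qed.

Lemma qi_neq0 : qi != 0.
Proof. by rewrite expf_neq0 // two_neq0. Qed.

Lemma qi_neq1 : (qi == 1) = false.
Proof.
apply/eqP => h; have := qi_sqr; rewrite h expr1n => /eqP.
by rewrite neq_opp // oner_eq0.
Qed.

Lemma qi_neqN1 : (qi == -1) = false.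
Proof.
apply/eqP => h; have := qi_sqr; rewrite h sqrrN expr1n => /eqP.
by rewrite neq_opp // oner_eq0.
Qed.

Lemma one_neqN1 : (1 == -1 :> 'F_p) = false.
Proof. by rewrite neq_opp // oner_eq0. Qed.

Lemma re_im_val :
  ((re_val 0 = 0) * (re_val 1 = 1) * (re_val (-1) = -1) * (re_val qi = 0)
   * (re_val (- qi) = 0) * (im_val 0 = 0) * (im_val 1 = 0) * (im_val (-1) = 0)
   * (im_val qi = 1) * (im_val (- qi) = -1))%type.
Proof.
by rewrite /re_val /im_val; do !split;
  rewrite ?eqr_oppLR ?opprK ?eqxx ?[_ == qi]eq_sym ?[_ == - qi]eq_sym
    ?[- qi == _]eqr_oppLR ?oppr0
    ?qi_neq1 ?qi_neqN1 ?one_neqN1 ?[-1 == 1]eq_sym ?[0 == _]eq_sym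
    ?oppr_eq0 ?oner_eq0 ?(negPf qi_neq0) ?(neq_opp qi_neq0) ?one_neqN1.
Qed.

Variant qchi_spec x : bool -> 'F_p -> int -> int -> Prop :=
| Qchi0 of x = 0 : qchi_spec x true 0 0 0
| Qchi1 : qchi_spec x false 1 1 0
| Qchi2 : qchi_spec x false qi 0 1
| Qchi3 : qchi_spec x false (-1) (-1) 0
| Qchi4 : qchi_spec x false (- qi) 0 (-1).

Lemma qchiP x : qchi_spec x (x == 0) (qchi x) (qre x) (qim x).
Proof.
have [->|x0] := eqVneq x 0.
  have q0 : qchi 0 = 0 by rewrite /qchi expr0n; case: m quarter_gt0.
  by rewrite /qre /qim q0 !re_im_val; constructor.
(* As [qi] ^ 2 = -1, this product is x ^ (4m) - 1. *)
have : (qchi x ^+ 2 - 1) * (qchi x ^+ 2 - qi ^+ 2) == 0.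
  rewrite qi_sqr opprK -subr_sqr expr1n -!exprM mulnC (expf_p1 x0).
  by rewrite subrr.
rewrite mulf_eq0 !subr_eq0 sqrf_eq1 eqf_sqr /qre /qim.
by case/orP => /orP [] /eqP ->; rewrite !re_im_val; constructor.
Qed.

Lemma qchiM x y : qchi (x * y) = qchi x * qchi y.
Proof. exact: exprMn. Qed.

Lemma qi_mul : qi * qi = -1. Proof. by rewrite -expr2 qi_sqr. Qed.

Ltac qsimp := rewrite ?(mul0r, mulr0, mulNr, mulrN, mul1r, mulr1, qi_mul, opprK,
  oppr0, addr0, add0r, re_im_val).

Lemma qreM x y : qre (x * y) = qre x * qre y - qim x * qim y.
Proof.
by rewrite {1}/qre qchiM; case: (qchiP x) => *; case: (qchiP y) => *; qsimp.
Qed.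

Lemma qimM x y : qim (x * y) = qre x * qim y + qim x * qre y.
Proof.
by rewrite {1}/qim qchiM; case: (qchiP x) => *; case: (qchiP y) => *; qsimp.
Qed.

Lemma qre0 : qre 0 = 0.
Proof. by case: qchiP (eqxx (0 : 'F_p)). Qed.

Lemma qim0 : qim 0 = 0.
Proof. by case: qchiP (eqxx (0 : 'F_p)). Qed.

Lemma qre1 : qre 1 = 1.
Proof. by rewrite /qre /qchi expr1n re_im_val. Qed.

Lemma qim1 : qim 1 = 0.
Proof. by rewrite /qim /qchi expr1n re_im_val. Qed.

Lemma qreV x : qre x^-1 = qre x.
Proof.
have [->|x0] := eqVneq x 0; first by rewrite invr0.
have := qreM x x^-1; have := qimM x x^-1; rewrite divff // qre1 qim1.
move: (qchiP x); rewrite (negPf x0); move: (qre x^-1) (qim x^-1) => a b.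
by case; lia.
Qed.

Lemma qimV x : qim x^-1 = - qim x.
Proof.
have [->|x0] := eqVneq x 0; first by rewrite invr0 qim0.
have := qreM x x^-1; have := qimM x x^-1; rewrite divff // qre1 qim1.
move: (qchiP x); rewrite (negPf x0); move: (qre x^-1) (qim x^-1) => a b.
by case; lia.
Qed.

Lemma qchiN1 : qchi (-1) = -1.
Proof. by rewrite /qchi -signr_odd odd_quarter. Qed.

Lemma qchi_valN1 : (qre (-1) = -1) * (qim (-1) = 0).
Proof. by rewrite /qre /qim qchiN1 !re_im_val. Qed.

Lemma qreN x : qre (- x) = - qre x.
Proof. by rewrite -mulN1r qreM !qchi_valN1; ring. Qed.

Lemma qimN x : qim (- x) = - qim x.
Proof. by rewrite -mulN1r qimM !qchi_valN1; ring. Qed.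

Lemma qre_div x y : qre (x / y) = qre x * qre y + qim x * qim y.
Proof. by rewrite qreM qreV qimV; ring. Qed.

Lemma qim_div x y : qim (x / y) = qim x * qre y - qre x * qim y.
Proof. by rewrite qimM qreV qimV; ring. Qed.

Lemma qrhoE x : qrho x = qre (x ^+ 2).
Proof. by rewrite expr2 qreM /qrho; ring. Qed.

Lemma qim_sqr x : qim (x ^+ 2) = 0.
Proof. by rewrite expr2 qimM; case: qchiP. Qed.

Lemma qrhoM x y : qrho (x * y) = qrho x * qrho y.
Proof. by rewrite !qrhoE exprMn qreM !qim_sqr; ring. Qed.

Lemma qrho0 : qrho 0 = 0.
Proof. by rewrite qrhoE expr0n qre0. Qed.

Lemma qrho_sqr x : x != 0 -> qrho x ^+ 2 = 1.
Proof. by rewrite /qrho; case: qchiP. Qed.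

Lemma sum_odd (f : 'F_p -> int) : (forall x, f (- x) = - f x) -> \sum_x f x = 0.
Proof.
move=> fN; have : \sum_x f x = - \sum_x f x.
  by rewrite {1}(reindex_inj oppr_inj) -sumrN; apply: eq_bigr.
by lia.
Qed.

Lemma sum_qre : \sum_x qre x = 0.
Proof. exact: sum_odd qreN. Qed.

Lemma sum_qim : \sum_x qim x = 0.
Proof. exact: sum_odd qimN. Qed.

Lemma sum_shift (f : 'F_p -> int) d : \sum_x f (x - d) = \sum_x f x.
Proof. by rewrite [RHS](reindex_inj (addIr (- d))). Qed.

Lemma sum_scale (f : 'F_p -> int) d : d != 0 -> \sum_x f (d * x) = \sum_x f x.
Proof. by move=> d0; rewrite [RHS](reindex_inj (mulfI d0)). Qed.

Lemma qchi2 : (qre 2%:R = 0) * (qim 2%:R = 1).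
Proof. by rewrite /qre /qim -/qi !re_im_val. Qed.

(** Scaling by 2, a nonresidue, negates the sum. *)
Lemma sum_qrho : \sum_x qrho x = 0.
Proof.
have : \sum_x qrho x = - \sum_x qrho x.
  rewrite -{1}(@sum_scale _ 2%:R two_neq0) -sumrN; apply: eq_bigr => x _.
  by rewrite qrhoM {1}/qrho !qchi2; ring.
by lia.
Qed.

(* Under [w = d + d / t] the quotient [w / (w - d)] becomes [1 + t], except at the
   junk value [t = 0]. *)
Lemma sum_div (f : 'F_p -> int) d : d != 0 -> f 0 = 0 ->
  \sum_w f (w / (w - d)) = \sum_x f x - f 1.
Proof.
move=> d0 f0; rewrite -[in RHS](@sum_shift f (-1)) [in RHS](bigD1 0) //= sub0r.
rewrite opprK [in RHS]addrAC subrr add0r (reindex_inj (addIr d)) (reindex_inj (mulfI d0)).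
rewrite (reindex_inj invr_inj) (bigD1 0) //= invr0 mulr0 add0r subrr invr0.
rewrite mulr0 f0 add0r; apply: eq_bigr => t t0; congr f.
by field; rewrite t0 mulNr addrK d0.
Qed.

(** The summand is the real part of chi (w / (w - d)). The quotient takes each nonzero value other
    than 1 exactly once, so the complete sum 0 loses the term chi 1 = 1. *)
Lemma qre_corr d : d != 0 ->
  \sum_w (qre w * qre (w - d) + qim w * qim (w - d)) = -1.
Proof.
move=> d0; under eq_bigr do rewrite -qre_div.
by rewrite (sum_div d0 qre0) sum_qre qre1.
Qed.

Lemma qim_corr d : d != 0 ->
  \sum_w (qim w * qre (w - d) - qre w * qim (w - d)) = 0.
Proof.
move=> d0; under eq_bigr do rewrite -qim_div.
by rewrite (sum_div d0 qim0) sum_qim qim1.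
Qed.

(** The coordinates alpha and beta of the Jacobi sum J(chi, chi). *)
Definition jre : int := \sum_x qre (x * (1 - x)).
Definition jim : int := \sum_x qim (x * (1 - x)).

(** With w = d x the argument is - d ^ 2 * x (1 - x), where chi (-1) = -1 and chi (d ^ 2) =
    [qrho d]. *)
Lemma sum_qre_mul d : d != 0 -> \sum_w qre (w * (w - d)) = - qrho d * jre.
Proof.
move=> d0; rewrite -(sum_scale _ d0) mulr_sumr; apply: eq_bigr => x _.
rewrite (_ : d * x * (d * x - d) = - (d ^+ 2 * (x * (1 - x)))); last by ring.
by rewrite qreN qreM qim_sqr -qrhoE; ring.
Qed.

Lemma sum_qim_mul d : d != 0 -> \sum_w qim (w * (w - d)) = - qrho d * jim.
Proof.
move=> d0; rewrite -(sum_scale _ d0) mulr_sumr; apply: eq_bigr => x _.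
rewrite (_ : d * x * (d * x - d) = - (d ^+ 2 * (x * (1 - x)))); last by ring.
by rewrite qimN qimM qim_sqr -qrhoE; ring.
Qed.

(* As [p = 5 %[mod 8]], a square root of [u] is a power of [u], up to a factor [qi]. *)
Lemma qrho1_sqrt u : qrho u = 1 -> exists2 y, y != 0 & u = y ^+ 2.
Proof.
have [->|u0] := eqVneq u 0; first by rewrite qrho0.
have um : (u ^+ (m.+1 %/ 2)) ^+ 2 = u * qchi u.
  by rewrite -exprM -exprS; congr (_ ^+ _); have := odd_quarter; lia.
have v0 : u ^+ (m.+1 %/ 2) != 0 by rewrite expf_neq0.
rewrite /qrho; move: um; case: qchiP => // [um _|um _].
  by exists (u ^+ (m.+1 %/ 2)) => //; rewrite um mulr1.
exists (u ^+ (m.+1 %/ 2) / qi); first by rewrite mulf_neq0 // invr_eq0 qi_neq0.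
by rewrite exprMn um exprVn qi_sqr invrN1 !mulrN1 opprK.
Qed.

Lemma card_sqrt u : (#|[pred y : 'F_p | y ^+ 2 == u]|%:Z = 1 + qrho u)%R.
Proof.
have [->|u0] := eqVneq u 0.
  rewrite qrho0 (eq_card (_ : _ =i pred1 0)) ?card1 // => y.
  by rewrite !inE sqrf_eq0.
have := qrho_sqr u0; move/eqP; rewrite sqrf_eq1 => /orP[] /eqP rho_u.
  have [y y0 yu] := qrho1_sqrt rho_u.
  rewrite (eq_card (_ : _ =i pred2 y (- y))) ?card2 ?neq_opp ?rho_u // => z.
  by rewrite !inE yu eqf_sqr.
rewrite rho_u eq_card0 // => y; rewrite !inE; apply/eqP => yu.
have y0 : y != 0 by apply: contra_neq u0 => y0; rewrite -yu y0 expr0n.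
by have := qrho_sqr y0; rewrite -yu expr2 qrhoM -expr2 in rho_u *; rewrite rho_u.
Qed.

Lemma sum_sqr (f : 'F_p -> int) :
  \sum_y f (y ^+ 2) = \sum_u (1 + qrho u) * f u.
Proof.
rewrite (partition_big (fun y => y ^+ 2) xpredT) //=; apply: eq_bigr => u _.
rewrite (eq_bigr (fun=> f u)) => [|y /eqP -> //].
by rewrite sumr_const -mulr_natl natz card_sqrt.
Qed.

Lemma four_neq0 : 4%:R != 0 :> 'F_p.
Proof. by rewrite (_ : 4%:R = 2%:R * 2%:R) ?mulf_neq0 ?two_neq0 // -natrM. Qed.

Lemma qchi4 : (qre 4%:R = -1) * (qim 4%:R = 0).
Proof.
rewrite (_ : 4%:R = 2%:R * 2%:R :> 'F_p); last by rewrite -natrM.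
by rewrite qreM qimM !qchi2.
Qed.

(* Substituting [x = (1 + y) / 2] turns [x * (1 - x)] into [(1 - y ^+ 2) / 4]. *)
Lemma sum_quartic_sqr (f : 'F_p -> int) : (forall x, f (4%:R * x) = - f x) ->
  (forall x, f (- x) = - f x) ->
  \sum_x f (x * (1 - x)) = \sum_y f (y ^+ 2 - 1).
Proof.
move=> f4 fN; rewrite -[RHS](sum_shift _ 1) -[RHS](sum_scale _ two_neq0).
apply: eq_bigr => x _.
rewrite (_ : _ - 1 = - (4%:R * (x * (1 - x)))); first by rewrite fN f4 opprK.
by ring.
Qed.

(** Rewriting J(chi, chi) as a sum over y ^ 2 - 1 and counting square roots gives each u the weight
    1 + [qrho u]; the constant part of the weight contributes a complete sum of chi, which is 0. *)
Lemma sum_qrho_qre1 : \sum_w qrho w * qre (w - 1) = jre.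
Proof.
rewrite /jre sum_quartic_sqr => [||x]; last 2 first.
- by move=> x; rewrite qreM !qchi4; ring.
- exact: qreN.
rewrite (sum_sqr (fun u => qre (u - 1))).
under [RHS]eq_bigr do rewrite mulrDl mul1r.
by rewrite big_split /= (sum_shift qre) sum_qre add0r.
Qed.

Lemma sum_qrho_qim1 : \sum_w qrho w * qim (w - 1) = jim.
Proof.
rewrite /jim sum_quartic_sqr => [||x]; last 2 first.
- by move=> x; rewrite qimM !qchi4; ring.
- exact: qimN.
rewrite (sum_sqr (fun u => qim (u - 1))).
under [RHS]eq_bigr do rewrite mulrDl mul1r.
by rewrite big_split /= (sum_shift qim) sum_qim add0r.
Qed.

Lemma sum_qrho_qim d : d != 0 ->
  \sum_w qrho w * qim (w - d) = qrho d * (qre d * jim + qim d * jre).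
Proof.
move=> d0; rewrite -(sum_scale _ d0) -sum_qrho_qre1 -sum_qrho_qim1.
rewrite !mulr_sumr -big_split mulr_sumr; apply: eq_bigr => x _.
by rewrite qrhoM (_ : d * x - d = d * (x - 1)) ?qimM /=; ring.
Qed.

(** Orthogonality for the double count in [jacobi_norm]. After replacing d by z - d the varying
    quotient is d / (d - (z - w)): for z = w it is 1 at the p - 1 nonzero d, and otherwise
    [qre_corr] and [qim_corr] apply. *)
Lemma qre_corr2 z w :
  \sum_d qre (z * (z - d) / (w * (w - d))) = ((z == w)%:R * p%:Z - 1) * qre (z / w).
Proof.
under eq_bigr do rewrite invfM mulrACA qreM.
rewrite sumrB -!mulr_sumr.
rewrite (reindex_inj (inj_comp (addrI z) oppr_inj)) /=.
rewrite [X in _ - _ * X](reindex_inj (inj_comp (addrI z) oppr_inj)) /=.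
have sub_sub d : (z - (z - d) = d) * (w - (z - d) = d - (z - w)) by split; ring.
have [<-|zw] := eqVneq z w.
  rewrite mul1r [X in _ * X](_ : _ = p%:Z - 1); last first.
    rewrite (bigD1 0) //= !sub_sub mul0r qre0 add0r.
    rewrite (eq_bigr (fun=> 1)) => [|d d0]; last first.
      by rewrite !sub_sub divff // qre1.
    by rewrite sumr_const cardC1 card_Fp // -mulr_natl mulr1; have := quarter_eq; lia.
  rewrite [X in _ - _ * X]big1 ?mulr0 ?subr0 1?mulrC // => d _.
  rewrite !sub_sub; have [->|d0] := eqVneq d 0.
    by rewrite mul0r qim0.
  by rewrite divff // qim1.
have zw0 : z - w != 0 by rewrite subr_eq0.
under eq_bigr do rewrite !sub_sub qre_div.
under [X in _ - _ * X]eq_bigr do rewrite !sub_sub qim_div.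
by rewrite qre_corr // qim_corr // mul0r mulr0 subr0 sub0r mulrC.
Qed.

(** The sum over d of the squared modulus of sum_w chi (w (w - d)) is computed twice. Each d != 0
    contributes the squared modulus of J(chi, chi) and d = 0 contributes 0; expanding the squares
    and summing over d first gives p (p - 1). *)
Lemma jacobi_norm : jre ^+ 2 + jim ^+ 2 = p%:Z.
Proof.
pose a d := \sum_w qre (w * (w - d)); pose b d := \sum_w qim (w * (w - d)).
have eqJ : \sum_d (a d ^+ 2 + b d ^+ 2) = (p%:Z - 1) * (jre ^+ 2 + jim ^+ 2).
  have a0 : a 0 = 0.
    by rewrite -sum_qrho; apply: eq_bigr => w _; rewrite subr0 -expr2 qrhoE.
  have b0 : b 0 = 0 by rewrite /b big1 // => w _; rewrite subr0 -expr2 qim_sqr.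
  rewrite (bigD1 0) //= a0 b0 expr0n !add0r.
  rewrite (eq_bigr (fun=> jre ^+ 2 + jim ^+ 2)) => [|d d0]; last first.
    rewrite /a /b sum_qre_mul // sum_qim_mul // !exprMn sqrrN qrho_sqr //.
    by rewrite !mul1r.
  by rewrite sumr_const cardC1 card_Fp // -mulr_natl; congr (_ * _); have := quarter_eq; lia.
have : \sum_d (a d ^+ 2 + b d ^+ 2) = p%:Z * (p%:Z - 1).
  transitivity (\sum_d \sum_z \sum_w qre (z * (z - d) / (w * (w - d)))).
    apply: eq_bigr => d _; rewrite !expr2 /a /b !big_distrlr -big_split /=.
    apply: eq_bigr => z _; rewrite -big_split /=; apply: eq_bigr => w _.
    by rewrite qre_div.
  rewrite exchange_big /=; under eq_bigr do rewrite exchange_big /=.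
  under eq_bigr do under eq_bigr do rewrite qre_corr2 mulrBl mul1r.
  under eq_bigr do rewrite sumrB.
  rewrite sumrB [X in _ - X]exchange_big [X in _ - X]big1 ?subr0 /= => [|w _].
    transitivity (\sum_(z : 'F_p | z != 0) p%:Z).
      rewrite [LHS](bigD1 0) //= [X in X + _]big1 ?add0r => [|w _]; last first.
        by rewrite mul0r qre0 mulr0.
      apply: eq_bigr => z z0; rewrite (bigD1 z) //= eqxx mul1r divff // qre1 mulr1.
      rewrite big1 ?addr0 // => w wz; rewrite eq_sym (negPf wz).
      by rewrite !mul0r.
    by rewrite sumr_const cardC1 card_Fp // -mulr_natr; congr (_ * _); have := quarter_eq; lia.
  have [->|w0] := eqVneq w 0.
    by rewrite big1 // => z _; rewrite invr0 mulr0 qre0.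
  by rewrite -[RHS]sum_qre [RHS](reindex_inj (mulIf (invr_neq0 w0))).
rewrite eqJ mulrC => /mulIf; apply.
by have := quarter_eq; have := quarter_gt0; lia.
Qed.

(** Otherwise [jacobi_norm] would make the prime p a square. *)
Lemma jim_neq0 : jim != 0.
Proof.
apply/eqP => j0; have := jacobi_norm; rewrite j0 expr0n addr0 => jp.
have : (`|jre| ^ 2 = p)%N by have := jp; rewrite -abszX => ->.
move=> /(f_equal (logn p)); rewrite lognX -[X in _ = logn _ X]expn1 pfactorK //.
by lia.
Qed.

End QuarticCharacter.

(** * Sign functions on the cosets of the fourth powers *)

Section SzekeresSigns.

Variable p : nat.
Hypotheses (p_pr : prime p) (p_mod8 : (p %% 8 = 5)%N).
Implicit Types x y z w d a b : 'F_p.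

Local Notation m := (p %/ 4)%N.

(** On nonzero elements, [fsign] is 1 exactly on H_4 and 2 H_4, and [gsign] is 1 exactly on H_4 and
    8 H_4; both are -1 on the remaining cosets. *)
Definition fsign x : int := qre x + qim x.
Definition gsign x : int := qre x - qim x.

Lemma fsignN x : fsign (- x) = - fsign x.
Proof. by rewrite /fsign qreN // qimN //; lia. Qed.

Lemma gsignN x : gsign (- x) = - gsign x.
Proof. by rewrite /gsign qreN // qimN //; lia. Qed.

Lemma fsign0 : fsign 0 = 0.
Proof. by rewrite /fsign qre0 // qim0. Qed.

Lemma gsign0 : gsign 0 = 0.
Proof. by rewrite /gsign qre0 // qim0. Qed.

Lemma fsign_sqr x : fsign x ^+ 2 = (x != 0)%:R.
Proof. by rewrite /fsign; case: qchiP. Qed.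

Lemma gsign_sqr x : gsign x ^+ 2 = (x != 0)%:R.
Proof. by rewrite /gsign; case: qchiP. Qed.

Lemma fgsign x : fsign x * gsign x = qrho x.
Proof. by rewrite /fsign /gsign /qrho; ring. Qed.

Lemma sum_fsign d : \sum_w fsign (w - d) = 0.
Proof. by rewrite sum_shift big_split /= sum_qre // sum_qim. Qed.

Lemma sum_gsign d : \sum_w gsign (w - d) = 0.
Proof. by rewrite sum_shift sumrB sum_qre // sum_qim. Qed.

Definition corr (h k : 'F_p -> int) d : int := \sum_w h w * k (w - d).

Lemma sum_shift2 (h k : 'F_p -> int) a b :
  \sum_w h (w - a) * k (w - b) = corr h k (b - a).
Proof.
rewrite -[RHS](sum_shift _ a); apply: eq_bigr => w _; congr (_ * k _).
by rewrite opprB addrA subrK.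
Qed.

(** Writing f = re + im and g = re - im, the four combinations of correlations here and below are
    twice the real or imaginary part of sum_w chi (w / (w - d)), for [fg_corr] and [fg_cross], or of
    sum_w chi (w (w - d)), for [fg_diff] and [fg_sum]. *)
Lemma fg_corr d : d != 0 ->
  corr fsign fsign d + corr gsign gsign d = -2.
Proof.
move=> d0; rewrite /corr -big_split /= (_ : -2 = 2 * -1) // -(qre_corr p_pr p_mod8 d0) mulr_sumr.
by apply: eq_bigr => w _; rewrite /fsign /gsign; ring.
Qed.

Lemma fg_diff d : d != 0 ->
  corr fsign fsign d - corr gsign gsign d =
  - 2 * qrho d * jim p.
Proof.
move=> d0; transitivity (2 * (- qrho d * jim p)); last by ring.
rewrite -sum_qim_mul // mulr_sumr -sumrB; apply: eq_bigr => w _.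
by rewrite qimM // /fsign /gsign; ring.
Qed.

Lemma fg_cross d :
  corr fsign gsign d = corr gsign fsign d.
Proof.
apply/eqP; rewrite -subr_eq0 /corr -sumrB; apply/eqP.
have [->|d0] := eqVneq d 0.
  by rewrite big1 // => w _; rewrite subr0 mulrC subrr.
rewrite -[RHS](mulr0 2) -[in RHS](qim_corr p_pr p_mod8 d0) mulr_sumr.
by apply: eq_bigr => w _; rewrite /fsign /gsign; ring.
Qed.

Lemma fg_sum d : d != 0 ->
  corr fsign gsign d + corr gsign fsign d =
  - 2 * qrho d * jre p.
Proof.
move=> d0; transitivity (2 * (- qrho d * jre p)); last by ring.
rewrite -sum_qre_mul // mulr_sumr -big_split; apply: eq_bigr => w _.
by rewrite qreM // /fsign /gsign /=; ring.
Qed.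

Lemma qrho_fg d : d != 0 ->
  corr (@qrho p) fsign d - corr (@qrho p) gsign d =
  2 * qrho d * (qre d * jim p + qim d * jre p).
Proof.
move=> d0; rewrite /corr -sumrB -mulrA -(sum_qrho_qim p_pr p_mod8 d0) mulr_sumr.
by apply: eq_bigr => w _; rewrite /fsign /gsign; ring.
Qed.

Lemma fourth_root x : qchi x = 1 -> exists2 y, y != 0 & x = y ^+ 4.
Proof.
move=> x1; have x0 : x != 0.
  apply: contra_eq_neq x1 => ->; rewrite /qchi expr0n.
  by case: m (quarter_gt0 p_pr p_mod8) => //= *; rewrite eq_sym oner_eq0.
(* As m is odd, 4 divides 1 + 3 m ^ 2; the fourth power of the witness is x * [qchi x] ^ (3m) =
   x. *)
exists (x ^+ ((1 + m * (3 * m)) %/ 4)); first by rewrite expf_neq0.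
rewrite -exprM divnK; last by have := odd_quarter p_pr p_mod8; nia.
by rewrite exprD exprM -/(qchi x) x1 expr1n mulr1.
Qed.

Lemma coset_H4E c x : c != 0 -> (x \in coset_H4 c) = (x != 0) && (qchi x == qchi c).
Proof.
move=> c0; apply/imsetP/andP => [[y] | [x0 /eqP xc]].
  rewrite inE => y0 ->; rewrite mulf_neq0 ?expf_neq0 //; split=> //.
  by rewrite qchiM /qchi -exprM expf_p1 // mulr1.
have [|y y0 xcy] := @fourth_root (x / c).
  by rewrite qchiM xc -qchiM divff // /qchi expr1n.
by exists y; rewrite ?inE // -xcy mulrC divfK.
Qed.

Lemma qval_neq :
  ((1 == qi p) = false) * ((qi p == 1) = false) * ((1 == - qi p) = false)
  * ((- qi p == 1) = false) * ((-1 == qi p) = false) * ((qi p == -1) = false)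
  * ((-1 == - qi p) = false) * ((- qi p == -1) = false)
  * ((1 == -1 :> 'F_p) = false) * ((-1 == 1 :> 'F_p) = false)
  * ((qi p == - qi p) = false) * ((- qi p == qi p) = false).
Proof.
have q1 := qi_neq1 p_pr p_mod8; have q2 := qi_neqN1 p_pr p_mod8.
have q3 := one_neqN1 p_pr p_mod8; have q4 := neq_opp p_pr p_mod8 (qi_neq0 p_pr p_mod8).
have q5 : (- qi p == 1) = false by rewrite eqr_oppLR.
have q6 : (- qi p == -1) = false by rewrite eqr_opp.
by do !split; rewrite // eq_sym.
Qed.

Lemma qchi_pow2 :
  (qchi 1 = 1 :> 'F_p) * (qchi 2%:R = qi p) * (qchi 4%:R = -1 :> 'F_p)
  * (qchi 8%:R = - qi p).
Proof.
have q4 : qchi 4%:R = -1 :> 'F_p.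
  have -> : 4%:R = 2%:R * 2%:R :> 'F_p by rewrite -natrM.
  by rewrite qchiM; exact: qi_mul.
do !split=> //; first exact: expr1n.
have -> : 8%:R = 2%:R * 4%:R :> 'F_p by rewrite -natrM.
by rewrite qchiM q4 mulrN1.
Qed.

Lemma eight_neq0 : 8%:R != 0 :> 'F_p.
Proof.
by rewrite (_ : 8%:R = 2%:R * 4%:R) ?mulf_neq0 ?two_neq0 ?four_neq0 // -natrM.
Qed.

Lemma coset_pow2E :
  [/\ forall x, (x \in coset_H4 1 :|: coset_H4 2%:R) = (fsign x == 1),
      forall x, (x \in coset_H4 4%:R :|: coset_H4 8%:R) = (fsign x == -1)
    & forall x, (x \in coset_H4 1 :|: coset_H4 8%:R) = (gsign x == 1)].
Proof.
split=> x; rewrite inE !coset_H4E ?oner_eq0 ?two_neq0 ?four_neq0 ?eight_neq0 //;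
by rewrite !qchi_pow2 /fsign /gsign; case: qchiP => *; rewrite ?eqxx ?qval_neq.
Qed.

End SzekeresSigns.

(** * The Szekeres tournament *)

Section SzekeresTournament.

Variable p : nat.
Hypotheses (p_pr : prime p) (p_mod8 : (p %% 8 = 5)%N).
Implicit Types (a b z w d : 'F_p) (u v x y : szekeres_vertex p).

(** The adjacency matrix minus its transpose. The delta terms stand for the arcs from (a, 0) to (a,
    1), where [gsign] vanishes. *)
Definition szsign u v : int :=
  match u, v with
  | None, None => 0
  | None, Some (_, c) => if c then -1 else 1
  | Some (_, c), None => if c then 1 else -1
  | Some (a, false), Some (b, false) => fsign (b - a)
  | Some (a, false), Some (b, true) => gsign (b - a) + (b == a)%:R
  | Some (a, true), Some (b, false) => gsign (b - a) - (b == a)%:R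
  | Some (a, true), Some (b, true) => - fsign (b - a)
  end.

Lemma layer_mem c c' a b (D : {set 'F_p}) :
  (Some (b, c') \in layer c a D) = (c' == c) && (b - a \in D).
Proof.
apply/imsetP/andP => [[d dD [-> ->]] | [/eqP -> baD]].
  by rewrite addrC addKr eqxx.
by exists (b - a) => //; rewrite addrC subrK.
Qed.

Lemma layerN c a (D : {set 'F_p}) : (None \in layer c a D) = false.
Proof. by apply/imsetP => [[]]. Qed.

Lemma some_pair_eq a b c c' :
  ((Some (b, c') : szekeres_vertex p) == Some (a, c)) = (b == a) && (c' == c).
Proof. by rewrite -xpair_eqE. Qed.

Lemma szekeresE u v : szekeres p u v = (szsign u v == 1).
Proof.
have [fP fN gP] := coset_pow2E p_pr p_mod8.
rewrite /szekeres /szekeres_out; case: u => [[a []]|]; case: v => [[b []]|] //.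
all: rewrite ?inE ?layer_mem ?layerN ?fP ?fN ?gP ?some_pair_eq //=.
all: rewrite ?orbF ?andbF ?andbT ?orbF ?eqr_oppLR //.
- have [->|ba] := eqVneq b a; first by rewrite subrr gsign0.
  by rewrite subr0.
- have [->|ba] := eqVneq b a; first by rewrite subrr gsign0.
  by rewrite addr0.
- by transitivity false => //; apply/imsetP => [[]].
- by rewrite imset_f.
- by transitivity false => //; apply/imsetP => [[]].
Qed.

Lemma szsignC u v : szsign v u = - szsign u v.
Proof.
case: u v => [[a []]|] [[b []]|] //=; rewrite -?[a - b]opprB ?fsignN ?gsignN //;
by rewrite ?(eq_sym a); ring.
Qed.

Lemma szsign_diag u : szsign u u = 0.
Proof. by have := szsignC u u; lia. Qed.

Lemma szsign_sqr u v : szsign u v ^+ 2 = (u != v)%:R.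
Proof.
case: u v => [[a []]|] [[b []]|] //=.
- by rewrite sqrrN fsign_sqr // subr_eq0 some_pair_eq andbT eq_sym.
- have [->|ba] := eqVneq b a; first by rewrite subrr gsign0 // some_pair_eq andbF.
  by rewrite subr0 gsign_sqr // subr_eq0 ba some_pair_eq andbF.
- have [->|ba] := eqVneq b a; first by rewrite subrr gsign0 // some_pair_eq andbF.
  by rewrite addr0 gsign_sqr // subr_eq0 ba some_pair_eq andbF.
- by rewrite fsign_sqr // subr_eq0 some_pair_eq andbT eq_sym.
Qed.

Lemma sum_vertex (h : szekeres_vertex p -> int) :
  \sum_v h v = h None + (\sum_w h (Some (w, false)) + \sum_w h (Some (w, true))).
Proof.
have sum_some : \sum_(v | v != None) h v = \sum_(x : 'F_p * bool) h (Some x).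
  by rewrite (reindex_omap Some id) => [|[x|]] //=; apply: eq_bigl => x; rewrite eqxx.
rewrite (bigD1 None) //= sum_some; congr (_ + _).
rewrite (eq_bigr (fun x : 'F_p * bool => h (Some (x.1, x.2)))) => [|[]//].
rewrite -(pair_bigA _ (fun w c => h (Some (w, c)))) /= -big_split.
by apply: eq_bigr => w _; rewrite big_bool /= addrC.
Qed.

Lemma sum_deltar (h : 'F_p -> int) a : \sum_w h w * (w == a)%:R = h a.
Proof.
by rewrite (bigD1 a) //= eqxx mulr1 big1 ?addr0 // => w /negPf ->; rewrite mulr0.
Qed.

Lemma sum_deltal (h : 'F_p -> int) a : \sum_w (w == a)%:R * h w = h a.
Proof. by under eq_bigr do rewrite mulrC; exact: sum_deltar. Qed.

Lemma sum_delta a : \sum_w (w == a)%:R = 1 :> int.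
Proof. by have := sum_deltar (fun=> 1) a; under eq_bigr do rewrite mul1r. Qed.

Lemma sum_mulDD (h k : 'F_p -> int) a b :
  \sum_w (h w + (w == a)%:R) * (k w + (w == b)%:R) =
  \sum_w h w * k w + h b + k a + (a == b)%:R.
Proof.
rewrite [a == b]eq_sym -(sum_deltar (fun w => (w == a)%:R) b).
by rewrite -(sum_deltar h b) -(sum_deltal k a) -!big_split; apply: eq_bigr => w _ /=; ring.
Qed.

Lemma sum_mulBB (h k : 'F_p -> int) a b :
  \sum_w (h w - (w == a)%:R) * (k w - (w == b)%:R) =
  \sum_w h w * k w - h b - k a + (a == b)%:R.
Proof.
rewrite [a == b]eq_sym -(sum_deltar (fun w => (w == a)%:R) b).
rewrite -(sum_deltar h b) -(sum_deltal k a) -!sumrB -big_split.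
by apply: eq_bigr => w _ /=; ring.
Qed.

Lemma sum_mulB (h k : 'F_p -> int) b :
  \sum_w h w * (k w - (w == b)%:R) = \sum_w h w * k w - h b.
Proof.
by rewrite -(sum_deltar h b) -sumrB; apply: eq_bigr => w _; rewrite mulrBr.
Qed.

Lemma sum_mulDN (h k : 'F_p -> int) a :
  \sum_w (h w + (w == a)%:R) * - k w = - (\sum_w h w * k w) - k a.
Proof.
rewrite -(sum_deltal k a) -sumrN -sumrB; apply: eq_bigr => w _.
by rewrite mulrN mulrDl opprD.
Qed.

Lemma sum_szsign u : \sum_v szsign u v = 0.
Proof.
rewrite sum_vertex; case: u => [[a []]|] /=.
- by rewrite sumrN sum_fsign // sumrB sum_gsign // sum_delta; ring.
- by rewrite sum_fsign // big_split /= sum_gsign // sum_delta; ring.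
by rewrite sumrN add0r subrr.
Qed.

Lemma card_szekeres_vertex : #|szekeres_vertex p| = (2 * p + 1)%N.
Proof. by rewrite card_option card_prod card_bool card_Fp // mulnC addn1. Qed.

(** Infinity contributes 1 and [fg_corr] gives -2; the two delta terms cancel because [gsign] is
    odd. *)
Lemma szsign_orth00 a b : a != b ->
  \sum_w szsign (Some (a, false)) w * szsign (Some (b, false)) w = -1.
Proof.
move=> ab; have ba0 : b - a != 0 by rewrite subr_eq0 eq_sym.
rewrite sum_vertex /= (sum_mulDD (fun w => gsign (w - a)) (fun w => gsign (w - b))).
rewrite (negPf ab) mulr0n (sum_shift2 (@fsign p) (@fsign p)) (sum_shift2 (@gsign p) (@gsign p)).
rewrite -[a - b]opprB gsignN //.
by have := fg_corr p_pr p_mod8 ba0; lra.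
Qed.

Lemma szsign_orth11 a b : a != b ->
  \sum_w szsign (Some (a, true)) w * szsign (Some (b, true)) w = -1.
Proof.
move=> ab; have ba0 : b - a != 0 by rewrite subr_eq0 eq_sym.
rewrite sum_vertex /= (sum_mulBB (fun w => gsign (w - a)) (fun w => gsign (w - b))).
under [X in _ + (_ + X)]eq_bigr do rewrite mulrNN.
rewrite (negPf ab) mulr0n (sum_shift2 (@fsign p) (@fsign p)) (sum_shift2 (@gsign p) (@gsign p)).
rewrite -[a - b]opprB gsignN //.
by have := fg_corr p_pr p_mod8 ba0; lra.
Qed.

(** Infinity contributes -1; the mixed correlations cancel by [fg_cross], and the delta terms
    because [fsign] is odd. *)
Lemma szsign_orth01 a b :
  \sum_w szsign (Some (a, false)) w * szsign (Some (b, true)) w = -1.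
Proof.
rewrite sum_vertex /= (sum_mulB (fun w => fsign (w - a)) (fun w => gsign (w - b))).
rewrite (sum_mulDN (fun w => gsign (w - a)) (fun w => fsign (w - b))).
rewrite (sum_shift2 (@fsign p) (@gsign p)) (sum_shift2 (@gsign p) (@fsign p)).
rewrite -[a - b]opprB fsignN //.
by have := fg_cross p_pr p_mod8 (b - a); lra.
Qed.

Lemma szsign_orth_infty0 a :
  \sum_w szsign None w * szsign (Some (a, false)) w = -1.
Proof.
rewrite sum_vertex /=; under eq_bigr do rewrite mul1r.
under [X in _ + (_ + X)]eq_bigr do rewrite mulN1r opprD.
rewrite sum_fsign // big_split /= !sumrN sum_gsign // sum_delta.
by ring.
Qed.

Lemma szsign_orth_infty1 a :
  \sum_w szsign None w * szsign (Some (a, true)) w = -1.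
Proof.
rewrite sum_vertex /=; under eq_bigr do rewrite mul1r.
under [X in _ + (_ + X)]eq_bigr do rewrite mulrNN mul1r.
rewrite sum_fsign // sumrB sum_gsign // sum_delta.
by ring.
Qed.

(** In matrix form s s^T = (2p + 1) I - J, which says that the tournament is doubly regular. *)
Lemma szsign_orth u v :
  \sum_w szsign u w * szsign v w = (u == v)%:R * (2 * p%:Z + 1) - 1.
Proof.
have [<-|uv] := eqVneq u v.
  under eq_bigr do rewrite -expr2 szsign_sqr.
  rewrite (bigD1 u) //= eqxx add0r (eq_bigr (fun=> 1)) => [|w wu]; last first.
    by rewrite eq_sym wu.
  rewrite sumr_const -[X in _ *+ X](_ : (#|szekeres_vertex p|.-1) = _); last first.
    by rewrite -(cardC1 u); apply: eq_card => x; rewrite !inE.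
  by rewrite card_szekeres_vertex addn1 /=; lia.
rewrite mul0r sub0r.
have symm x y : \sum_w szsign x w * szsign y w = \sum_w szsign y w * szsign x w.
  by apply: eq_bigr => w _; rewrite mulrC.
case: u v uv => [[a []]|] [[b []]|] //.
- by rewrite some_pair_eq andbT; exact: szsign_orth11.
- by rewrite symm szsign_orth01.
- by rewrite symm szsign_orth_infty1.
- by rewrite szsign_orth01.
- by rewrite some_pair_eq andbT; exact: szsign_orth00.
- by rewrite symm szsign_orth_infty0.
- by rewrite szsign_orth_infty1.
- by rewrite szsign_orth_infty0.
Qed.

End SzekeresTournament.

(** * Intransitivity of the Szekeres tournament *)

Section SzekeresIntransitive.

Variable p : nat.
Hypotheses (p_pr : prime p) (p_mod8 : (p %% 8 = 5)%N).
Implicit Types (a b z w d : 'F_p) (u v x y : szekeres_vertex p).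

Definition triple u x y : int :=
  \sum_v szsign u v * (szsign x v * szsign y v).

Lemma triple_rot u x y : triple u x y = triple y u x.
Proof. by apply: eq_bigr => v _; ring. Qed.

(** The row of infinity is 1 on layer 0 and -1 on layer 1, so the triple product is the difference
    of correlations in [fg_diff]. In [triple_infty01] the same signs produce the sum in [fg_sum],
    with delta terms that now add up. *)
Lemma triple_infty00 z : z != 0 ->
  triple None (Some (0, false)) (Some (z, false)) = - 2 * qrho z * jim p.
Proof.
move=> z0; rewrite /triple sum_vertex /=.
under eq_bigr do rewrite mul1r.
under [X in _ + (_ + X)]eq_bigr do rewrite mulN1r.
rewrite sumrN (sum_mulDD (fun w => gsign (w - 0)) (fun w => gsign (w - z))).
rewrite (sum_shift2 (@fsign p) (@fsign p)) (sum_shift2 (@gsign p) (@gsign p)).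
rewrite eq_sym (negPf z0) mulr0n subr0 sub0r gsignN // -fg_diff //.
by ring.
Qed.

Lemma triple_infty01 z :
  triple None (Some (0, false)) (Some (z, true)) =
  if z == 0 then 0 else - 2 * qrho z * jre p - 2 * fsign z.
Proof.
rewrite /triple sum_vertex /=.
under eq_bigr do rewrite mul1r.
under [X in _ + (_ + X)]eq_bigr do rewrite mulN1r.
rewrite sumrN (sum_mulB (fun w => fsign (w - 0)) (fun w => gsign (w - z))).
rewrite (sum_mulDN (fun w => gsign (w - 0)) (fun w => fsign (w - z))).
rewrite (sum_shift2 (@fsign p) (@gsign p)) (sum_shift2 (@gsign p) (@fsign p)).
rewrite subr0 sub0r fsignN //; have [->|z0] := eqVneq z 0.
  rewrite fsign0 // -fg_cross // {1 2}/corr.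
  under eq_bigr do rewrite subr0 fgsign.
  by rewrite sum_qrho.
by rewrite -fg_sum //; ring.
Qed.

(** Both layers carry the factor f * g = [qrho], since the delta terms at w = 0 are killed by
    [fsign 0 = 0]. Infinity contributes 1, and the delta term at w = z contributes [- qrho z]. *)
Lemma triple_000100 z : z != 0 ->
  triple (Some (0, false)) (Some (0, true)) (Some (z, false)) =
  1 - qrho z + 2 * qrho z * (qre z * jim p + qim z * jre p).
Proof.
move=> z0; rewrite /triple sum_vertex /=.
rewrite (eq_bigr (fun w => qrho w * fsign (w - z))) => [|w _]; last first.
  rewrite subr0 -fgsign; have [->|w0] := eqVneq w 0; first by rewrite fsign0 // !mul0r.
  by rewrite subr0 mulrA.
rewrite [X in _ + (_ + X)](eq_bigr (fun w =>
    - (qrho w * gsign (w - z)) - qrho w * (w == z)%:R)) => [|w _]; last first.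
  rewrite subr0 -fgsign; have [->|w0] := eqVneq w 0.
    by rewrite fsign0 // oppr0 !mul0r mulr0 oppr0 subrr.
  by rewrite addr0; ring.
rewrite sumrB sumrN sum_deltar -(qrho_fg p_pr p_mod8 z0) /corr.
by ring.
Qed.

Lemma szsignB u v : szsign u v = (szekeres p u v)%:R - (szekeres p v u)%:R.
Proof.
rewrite !szekeresE // (szsignC p_pr p_mod8 u v).
have := szsign_sqr p_pr p_mod8 u v; case: eqP => _ /= /eqP.
  by rewrite sqrf_eq0 => /eqP ->.
by rewrite sqrf_eq1 => /orP[] /eqP ->.
Qed.

Definition translate a v : szekeres_vertex p :=
  omap (fun x : 'F_p * bool => (x.1 + a, x.2)) v.

Lemma translate_inj a : injective (translate a).
Proof.
move=> [[x c]|] [[y c']|] //= /eqP; rewrite some_pair_eq => /andP[/eqP xy /eqP ->].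
by rewrite (addIr a xy).
Qed.

Lemma szsign_translate a u v : szsign (translate a u) (translate a v) = szsign u v.
Proof.
have addBB (x y : 'F_p) : x + a - (y + a) = x - y by rewrite opprD addrACA subrr addr0.
by case: u v => [[x []]|] [[y []]|] //=; rewrite addBB ?(inj_eq (addIr a)).
Qed.

Definition sz_hom (phi : szekeres_vertex p -> szekeres_vertex p) :=
  forall u v, szekeres p (phi u) (phi v) = szekeres p u v.

Lemma triple_hom phi u x y : injective phi -> sz_hom phi ->
  triple (phi u) (phi x) (phi y) = triple u x y.
Proof.
move=> phi_inj phiE; rewrite [LHS](reindex_inj phi_inj); apply: eq_bigr => v _.
by rewrite !szsignB !phiE.
Qed.

Lemma infty_out u : szekeres p None u -> exists a, u = Some (a, false).
Proof. by rewrite szekeresE //; case: u => [[a []]|] //; exists a. Qed.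

Hypothesis p_ge13 : (13 <= p)%N.

Lemma no_hom_along_arcs phi : injective phi -> sz_hom phi ->
  phi None = Some (0, false) -> phi (Some (0, false)) = Some (0, true) -> False.
Proof.
move=> phi_inj phiE phi_infty phi_00.
have phiT := triple_hom _ _ _ phi_inj phiE.
have phi_surj u : exists v, phi v = u.
  by exists (invF phi_inj u); rewrite f_invF.
have rho_sqr z : z != 0 -> qrho z = 1 \/ qrho z = -1.
  by move=> z0; have /eqP := qrho_sqr p_pr p_mod8 z0; rewrite sqrf_eq1 => /orP[]/eqP; auto.
have jn := jacobi_norm p_pr p_mod8; have j0 := jim_neq0 p_pr p_mod8.
(* The vertex (2, 0) is an out-neighbour of (0, 0), so its preimage is some (z, 0). Equating the
   triple products gives 2 - 2 alpha = +- 2 beta. *)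
have eq_jim : (1 - jre p) ^+ 2 = jim p ^+ 2.
  have [v vE] := phi_surj (Some (2%:R, false)).
  have [z zE] : exists z, v = Some (z, false).
    apply: infty_out; rewrite -phiE phi_infty vE szekeresE //= subr0.
    by rewrite /fsign !qchi2.
  have z0 : z != 0 by apply/eqP => z0; move: vE; rewrite zE z0 phi_00.
  have := phiT None (Some (0, false)) v.
  rewrite vE phi_infty phi_00 zE triple_infty00 // triple_000100 ?two_neq0 //.
  rewrite {1 2}/qrho !qchi2 //.
  by case: (rho_sqr _ z0) => ->; nia.
(* alpha = 1 would give beta = 0, and alpha = -1 would give beta ^ 2 = 4, hence p = 5. *)
have jre_neq : jre p <> 1 /\ jre p <> -1.
  split=> j1; move: eq_jim jn; rewrite j1; last by lia.
  by move=> /esym/eqP; rewrite subrr expr0n sqrf_eq0 (negPf j0).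
(* The triple product of (0, 0), (0, 1), infinity is 0, so the preimage of infinity has triple
   product 0 with infinity and (0, 0). As beta is nonzero and alpha is not +- 1, only (0, 1)
   qualifies. *)
have phi_01 : phi (Some (0, true)) = None.
  have [v vE] := phi_surj None.
  have := phiT None (Some (0, false)) v.
  rewrite vE phi_infty phi_00 triple_rot triple_infty01 eqxx.
  case: v vE => [[z []]|] vE; last by rewrite phi_infty in vE.
    have [z0 _|z0] := eqVneq z 0; first by rewrite -vE z0.
    rewrite triple_infty01 (negPf z0).
    have /eqP := fsign_sqr p_pr p_mod8 z; rewrite z0 sqrf_eq1.
    by case: (rho_sqr _ z0) => -> /orP[] /eqP ->; lia.
  have z0 : z != 0 by apply/eqP => z0; move: vE; rewrite z0 phi_00.
  by rewrite triple_infty00 //; case: (rho_sqr _ z0) => ->; lia.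
have s1 : @fsign p 1 = 1 /\ @gsign p 1 = 1.
  by rewrite /fsign /gsign qre1 // qim1 //.
(* The triangle is now rotated, and (1, 0) is a common out-neighbour of its vertices. Hence so is
   its image (z, 0), which forces chi z = 1, and the two triple products are -2 beta and 2 beta. *)
have [z zE] : exists z, phi (Some (1, false)) = Some (z, false).
  apply: infty_out; rewrite -phi_01 phiE szekeresE //= !subr0.
  by rewrite s1.2.
have fz : fsign z = 1.
  have := szsignB (phi None) (phi (Some (1, false))).
  by rewrite !phiE -szsignB phi_infty zE /= subr0.
have gz : gsign z = 1.
  have := szsignB (phi (Some (0, false))) (phi (Some (1, false))).
  rewrite !phiE -szsignB phi_00 zE /= !subr0 s1.1.
  by have [z0|_] := eqVneq z 0; [move: fz; rewrite z0 fsign0 | rewrite subr0].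
have z0 : z != 0 by apply/eqP => z0; move: fz; rewrite z0 fsign0.
have := phiT None (Some (0, false)) (Some (1, false)).
rewrite phi_infty phi_00 zE triple_infty00 ?oner_eq0 // triple_000100 //.
rewrite /qrho qre1 // qim1 //.
have [-> ->] : qre z = 1 /\ qim z = 0 by move: fz gz; rewrite /fsign /gsign; lia.
by move: j0; lia.
Qed.

(** Translations fix infinity and move (0, 0) to any of its out-neighbours, in particular to the
    preimage of (0, 1), so that [no_hom_along_arcs] applies to the composite. *)
Lemma szekeres_intransitive phi : injective phi -> sz_hom phi ->
  phi None <> Some (0, false).
Proof.
move=> phi_inj phiE phi_infty.
have [v vE] : exists v, phi v = Some (0, true).
  by exists (invF phi_inj (Some (0, true))); rewrite f_invF.
have [a aE] : exists a, v = Some (a, false).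
  by apply: infty_out; rewrite -phiE phi_infty vE szekeresE //= subrr gsign0 // eqxx.
apply: (@no_hom_along_arcs (phi \o translate a)).
- exact: inj_comp phi_inj (@translate_inj a).
- by move=> x y; rewrite phiE !szekeresE // szsign_translate.
- by [].
- by rewrite /= add0r -aE.
Qed.

End SzekeresIntransitive.

(** * Matrices constant on the classes of a coherent configuration *)

Section ClassConstant.

Variable V : finType.
Implicit Types (X : {set {set V * V}}) (r s : {set V * V}) (x y z : V).

Definition class_constant (T : Type) X (M : V -> V -> T) : Prop :=
  forall s, s \in X ->
  forall x y x' y', (x, y) \in s -> (x', y') \in s -> M x y = M x' y'.

(** The adjacency algebra over any field: over [R[i]] it is [adjacency_algebra], and over the
    rationals it serves the rank bound, whose proof uses positivity. *)
Definition adj_span (K : fieldType) X : {vspace 'M[K]_#|V|} :=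
  <<[seq adjmx K (rel_of_set r) | r <- enum X]>>%VS.

Definition mxfun (K : Type) (M : 'M[K]_#|V|) x y := M (enum_rank x) (enum_rank y).

Lemma mxfun_adjmx (K : pzRingType) (e : rel V) x y : mxfun (adjmx K e) x y = (e x y)%:R.
Proof. by rewrite /mxfun mxE !enum_rankK. Qed.

Lemma mxfunM (K : pzRingType) (M N : 'M[K]_#|V|) x y :
  mxfun (M *m N) x y = \sum_z mxfun M x z * mxfun N z y.
Proof.
rewrite /mxfun mxE (reindex_onto enum_rank enum_val) /= => [|i _]; last exact: enum_valK.
by apply: eq_bigl => z; rewrite enum_rankK eqxx.
Qed.

Lemma mxfunP (K : Type) (M N : 'M[K]_#|V|) :
  (forall x y, mxfun M x y = mxfun N x y) -> M = N.
Proof.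
by move=> eqMN; apply/matrixP => i j; rewrite -(enum_valK i) -(enum_valK j); exact: eqMN.
Qed.

Lemma class_eq X r s xy : partition X [set: V * V] -> r \in X -> s \in X ->
  xy \in r -> xy \in s -> r = s.
Proof.
case/and3P=> _ tX _ rX sX xyr xys.
by rewrite -(def_pblock tX rX xyr) (def_pblock tX sX xys).
Qed.

Lemma class_of X xy : partition X [set: V * V] -> exists2 r, r \in X & xy \in r.
Proof.
case/and3P=> /eqP coverX _ _; have : xy \in cover X by rewrite coverX inE.
by case/bigcupP => r; exists r.
Qed.

Lemma class_constant_mem X r : partition X [set: V * V] -> r \in X ->
  class_constant X (fun x y => (x, y) \in r).
Proof.
move=> pX rX s sX x y x' y' xys xys'.
apply/idP/idP => h.
  by rewrite (class_eq pX rX sX h xys).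
by rewrite (class_eq pX rX sX h xys').
Qed.

Lemma class_constant_comp (T U : Type) X (M : V -> V -> T) (h : T -> U) :
  class_constant X M -> class_constant X (fun x y => h (M x y)).
Proof. by move=> cM s sX x y x' y' hs hs'; rewrite (cM s sX x y x' y'). Qed.

Lemma class_decomp (K : pzRingType) X (M : V -> V -> K) :
  partition X [set: V * V] -> class_constant X M ->
  exists c : {set V * V} -> K,
    forall x y, M x y = \sum_(r in X) c r * ((x, y) \in r)%:R.
Proof.
move=> pX cM.
(* The coefficient of a class is the value of [M] at any of its pairs; the default 0 concerns the
   empty set only, which is not a class. *)
exists (fun r => if [pick xy in r] is Some xy then M xy.1 xy.2 else 0) => x y.
have [r rX xyr] := class_of (x, y) pX.
rewrite (bigD1 r) //= xyr mulr1 big1 ?addr0 => [|s /andP[sX sr]]; last first.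
  case: (boolP (_ \in s)) => [xys|_]; last by rewrite mulr0.
  by rewrite (class_eq pX sX rX xys xyr) eqxx in sr.
case: pickP => [[x' y'] /= xyr' | /(_ (x, y))]; last by rewrite xyr.
exact: cM rX _ _ _ _ xyr xyr'.
Qed.

Lemma adj_spanP (K : fieldType) X (M : 'M[K]_#|V|) :
  partition X [set: V * V] ->
  (M \in adj_span K X) <-> class_constant X (mxfun M).
Proof.
move=> pX; split=> [MX | cM].
  move=> s sX x y x' y' xys xys'.
  pose S := [seq adjmx K (rel_of_set r) | r <- enum X].
  rewrite (coord_span (X := in_tuple S) MX) /mxfun !summxE.
  apply: eq_bigr => i _; rewrite !mxE; congr (_ * _).
  have /mapP[r rX ->] : S`_i \in S by rewrite mem_nth.
  rewrite -!/(mxfun _ _ _) !mxfun_adjmx; congr (_%:R).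
  rewrite mem_enum in rX.
  by rewrite /rel_of_set (class_constant_mem pX rX sX xys xys').
have [c cE] := class_decomp pX cM.
have -> : M = \sum_(r in X) c r *: adjmx K (rel_of_set r).
  apply: mxfunP => x y; rewrite cE /mxfun summxE; apply: eq_bigr => r _.
  by rewrite mxE; congr (_ * _); rewrite -/(mxfun _ _ _) mxfun_adjmx.
apply: memv_suml => r rX; apply/memvZ/memv_span/mapP; exists r => //.
by rewrite mem_enum.
Qed.

Lemma adj_span_adjmx (K : fieldType) X (e : rel V) : partition X [set: V * V] ->
  (adjmx K e \in adj_span K X) <-> class_constant X e.
Proof.
move=> pX; rewrite adj_spanP //; split=> ce.
  move=> s sX x y x' y' xys xys'; have := ce s sX x y x' y' xys xys'.
  rewrite !mxfun_adjmx; case: (e x y); case: (e x' y') => // /eqP.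
    by rewrite oner_eq0.
  by rewrite eq_sym oner_eq0.
move=> s sX x y x' y' xys xys'; rewrite !mxfun_adjmx.
by rewrite (ce s sX x y x' y').
Qed.

Lemma class_constant_converse (T : Type) X (M : V -> V -> T) : is_coherent X ->
  class_constant X M -> class_constant X (fun x y => M y x).
Proof.
move=> [_ _ convX _] cM s sX x y x' y' xys xys'.
by apply: (cM _ (convX s sX)); rewrite inE.
Qed.

Lemma class_constant_diag X : is_coherent X -> class_constant X (fun x y => x == y).
Proof.
move=> [pX [D DX diagE] _ _] s sX.
suff sub x y x' y' : (x, y) \in s -> (x', y') \in s -> x == y -> x' == y'.
  by move=> x y x' y' h h'; apply/idP/idP; apply: sub.
move=> xys xys' xy; have : (x, y) \in diagonal V by rewrite inE.
rewrite diagE => /bigcupP[r rD xyr].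
have rs : r = s by apply: class_eq pX _ sX xyr xys; apply: (subsetP DX).
have : (x', y') \in diagonal V by rewrite diagE; apply/bigcupP; exists r => //; rewrite rs.
by rewrite inE.
Qed.

(** The product is a fixed combination of the intersection numbers of the configuration. *)
Lemma class_constant_mul (K : comPzRingType) X (M N : V -> V -> K) : is_coherent X ->
  class_constant X M -> class_constant X N ->
  class_constant X (fun x y => \sum_z M x z * N z y).
Proof.
move=> [pX _ _ pijk] cM cN.
have [c cE] := class_decomp pX cM; have [d dE] := class_decomp pX cN.
have MNE x y : \sum_z M x z * N z y = \sum_(r in X) \sum_(s in X)
    c r * d s * #|[set z | ((x, z) \in r) && ((z, y) \in s)]|%:R.
  transitivity (\sum_z \sum_(r in X) \sum_(s in X)
      c r * d s * (((x, z) \in r) && ((z, y) \in s))%:R).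
    apply: eq_bigr => z _; rewrite cE dE big_distrlr; apply: eq_bigr => r _.
    by apply: eq_bigr => s _ /=; rewrite mulrACA -natrM mulnb.
  rewrite exchange_big; apply: eq_bigr => r _ /=.
  rewrite exchange_big; apply: eq_bigr => s _ /=.
  rewrite -mulr_sumr -natr_sum -sum1_card big_mkcond /=; congr (_ * _%:R).
  by rewrite [RHS]big_mkcond /=; apply: eq_bigr => z _; rewrite inE; case: (_ && _).
move=> u uX x y x' y' h h'; rewrite !MNE.
apply: eq_bigr => r rX; apply: eq_bigr => s sX; congr (_ * _%:R).
by have [q qE] := pijk r s u rX sX uX; rewrite !qE.
Qed.

Lemma coarserP X Y : partition X [set: V * V] -> partition Y [set: V * V] ->
  (forall r, r \in X -> class_constant Y (fun x y => (x, y) \in r)) -> coarser X Y.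
Proof.
move=> pX /and3P[_ _ Y0] cXY s sY.
have /set0Pn[[x y] xys] : s != set0 by apply: contraNneq Y0 => <-.
have [r rX xyr] := class_of (x, y) pX; exists r => //.
by apply/subsetP => [[x' y']] h; rewrite -(cXY r rX s sY x y x' y' xys h).
Qed.

End ClassConstant.

(** * Proper directed strongly regular graphs *)

Section FrobeniusNorm.

Variables (F : realFieldType) (n : nat).
Implicit Types M : 'M[F]_n.

Definition sqnorm M : F := \tr (M *m M^T).

Lemma sqnormE M : sqnorm M = \sum_i \sum_j M i j ^+ 2.
Proof.
apply: eq_bigr => i _; rewrite mxE; apply: eq_bigr => j _.
by rewrite mxE expr2.
Qed.

Lemma sqnorm_ge0 M : 0 <= sqnorm M.
Proof. by rewrite sqnormE; do 2!apply: sumr_ge0 => ? _; exact: sqr_ge0. Qed.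

Lemma sqnorm_eq0 M : sqnorm M = 0 -> M = 0.
Proof.
rewrite sqnormE => /eqP; rewrite psumr_eq0 => [/allP h | i _]; last first.
  by apply: sumr_ge0 => j _; exact: sqr_ge0.
apply/matrixP => i j; rewrite mxE; move: (h i (mem_index_enum i)).
rewrite psumr_eq0 => [/allP h' | j' _]; last exact: sqr_ge0.
by have := h' j (mem_index_enum j); rewrite /= sqrf_eq0 => /eqP.
Qed.

Lemma sqnorm_sym M : M^T = M -> sqnorm M = \tr (M *m M).
Proof. by rewrite /sqnorm => ->. Qed.

End FrobeniusNorm.

Ltac mxlin := apply/matrixP => ? ?; rewrite !mxE; ring.

(** * Normal adjacency matrices: symmetric graphs and tournaments *)

Section NormalDSRG.

Variables (F : realFieldType) (n : nat) (e : rel 'I_n) (A : 'M[F]_n).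
Variables (k t lam mu : F).
Hypothesis n_neq0 : n%:R != 0 :> F.
Hypothesis AE : A = \matrix_(i, j) (e i j)%:R.
Hypothesis e_irr : irreflexive e.
Local Notation J := (const_mx 1 : 'M[F]_n).
Local Notation Id := (1%:M : 'M[F]_n).
Hypotheses (AJ : A *m J = k *: J) (JA : J *m A = k *: J).
Hypothesis AA : A *m A = t *: Id + lam *: A + mu *: (J - Id - A).

Local Notation a := (lam - mu).
Local Notation b := (t - mu).
Local Notation delta := (a ^+ 2 + 4 * b).
Local Notation c := ((2 * k - a) / n%:R).
Local Notation At := A^T.

Lemma dsrg_sqr : A *m A = a *: A + b *: Id + mu *: J.
Proof. by rewrite AA; move: Id J => I0 J0; mxlin. Qed.

Lemma dsrg_sqr_tr : At *m At = a *: At + b *: Id + mu *: J.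
Proof.
by rewrite -trmx_mul dsrg_sqr !linearD !linearZ /= trmx1 trmx_const.
Qed.

Lemma mulmx_const1 : J *m J = n%:R *: J.
Proof.
apply/matrixP => i j; rewrite !mxE (eq_bigr (fun=> 1)) => [|? _].
  by rewrite sumr_const card_ord mulr1.
by rewrite !mxE mulr1.
Qed.

Lemma dsrg_trmx_mulJ : At *m J = k *: J.
Proof. by rewrite -[J]trmx_const -trmx_mul JA linearZ. Qed.

Lemma dsrg_mulJ_trmx : J *m At = k *: J.
Proof. by rewrite -[J]trmx_const -trmx_mul AJ linearZ. Qed.

Lemma normal_sym_or_tournament : A *m At = At *m A ->
  At = A \/ forall i j, i != j -> A i j + A j i = 1.
Proof.
move=> N; pose K := A - At; pose S := A + At.
have [K0 | K_neq0] := eqVneq K 0.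
  by left; apply/esym/eqP; rewrite -subr_eq0; apply/eqP.
right; have KJ : K *m J = 0 by rewrite mulmxBl AJ dsrg_trmx_mulJ subrr.
have JK : J *m K = 0 by rewrite mulmxBr JA dsrg_mulJ_trmx subrr.
have KS : K *m S = a *: K.
  rewrite mulmxDr !mulmxBl dsrg_sqr dsrg_sqr_tr N /K.
  by move: (At *m A) Id J => X I0 J0; mxlin.
have SK : S *m K = a *: K.
  rewrite mulmxBr !mulmxDl dsrg_sqr dsrg_sqr_tr N /K.
  by move: (At *m A) Id J => X I0 J0; mxlin.
have SS : S *m S = (2 * a) *: S + (4 * b) *: Id + (4 * mu) *: J - K *m K.
  rewrite /S /K mulmxBr !mulmxBl mulmxDr !mulmxDl dsrg_sqr dsrg_sqr_tr N.
  by move: (At *m A) Id J => X I0 J0; mxlin.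
have Kt : K^T = - K by rewrite linearB /= trmxK opprB.
have St : S^T = S by rewrite linearD /= trmxK addrC.
have SJ : S *m J = (2 * k) *: J by rewrite mulmxDl AJ dsrg_trmx_mulJ; move: J => J0; mxlin.
have SE : forall i j, S i j = A i j + A j i by move=> i j; rewrite !mxE.
have KE : forall i j, K i j = A i j - A j i by move=> i j; rewrite !mxE.
clearbody S K.
(* K ^ 2 is replaced by means of [SS]; then K J = 0 and K S = a K leave the coefficient 2 a ^ 2 + 4
   b - a ^ 2 = delta. *)
have KKK : K *m (K *m K) = delta *: K.
  have -> : K *m K = (2 * a) *: S + (4 * b) *: Id + (4 * mu) *: J - S *m S.
    by rewrite SS; move: (K *m K) Id J => X I0 J0; mxlin.
  rewrite mulmxBr !mulmxDr -!scalemxAr mulmx1 KJ KS mulmxA KS -scalemxAl KS.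
  by mxlin.
have trKK : \tr (K *m K) = - sqnorm K by rewrite /sqnorm Kt mulmxN linearN /= opprK.
have sqKK : sqnorm (K *m K) = - delta * sqnorm K.
  rewrite sqnorm_sym ?trmx_mul ?Kt ?mulNmx ?mulmxN ?opprK //.
  by rewrite -mulmxA KKK -scalemxAr linearZ /= trKK; ring.
have K_gt0 : 0 < sqnorm K.
  rewrite lt_def sqnorm_ge0 andbT; apply: contra_neq K_neq0; exact: sqnorm_eq0.
(* If delta >= 0, then |K ^ 2| ^ 2 = - delta |K| ^ 2 forces K ^ 2 = 0, and |K| ^ 2 = - tr (K ^ 2) =
   0. *)
have d_lt0 : delta < 0.
  rewrite ltNge; apply/negP => d_ge0.
  have /sqnorm_eq0 KK0 : sqnorm (K *m K) = 0.
    apply/eqP; rewrite eq_le sqnorm_ge0 andbT sqKK mulNr oppr_le0.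
    by apply: mulr_ge0 => //; exact: ltW.
  by move: trKK K_gt0; rewrite KK0 linear0; lra.
(* Here c is chosen so that T J = 0, while S K = a K gives T K = 0. *)
pose T := S - a *: Id - c *: J.
have Tt : T^T = T by rewrite /T !linearB !linearZ /= St trmx1 trmx_const.
have TJ : T *m J = 0.
  rewrite !mulmxBl SJ -!scalemxAl mul1mx mulmx_const1.
  by move: J => J0; apply/matrixP => i j; rewrite !mxE; field.
have JT : J *m T = 0 by rewrite -[J]trmx_const -Tt -trmx_mul TJ linear0.
have TK : T *m K = 0.
  by rewrite !mulmxBl -!scalemxAl mul1mx SK JK; mxlin.
have STE : S = T + a *: Id + c *: J by rewrite /T; move: Id J => I0 J0; mxlin.
have TE i j : T i j = A i j + A j i - a * (i == j)%:R - c.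
  by rewrite /T !mxE SE mulr_natr mulr1.
clearbody T.
have [u TT] : exists u, T *m T = delta *: Id + u *: J - K *m K.
  exists (4 * mu + 2 * a * c - 2 * a * c - c ^+ 2 * n%:R).
  move: SS; rewrite STE !mulmxDr !mulmxDl -!scalemxAr -!scalemxAl !mul1mx !mulmx1.
  rewrite TJ JT mulmx_const1 => /matrixP SS; apply/matrixP => i j; have := SS i j.
  move: (T *m T) (K *m K) Id J => X Y I0 J0.
  by rewrite !mxE => h; lra.
(* As T annihilates J and K, |T ^ 2| ^ 2 = delta |T| ^ 2; the left side is nonnegative and delta is
   negative. *)
have T0 : T = 0.
  apply: sqnorm_eq0; apply/eqP; rewrite eq_le sqnorm_ge0 andbT.
  have := sqnorm_ge0 (T *m T); rewrite sqnorm_sym ?trmx_mul ?Tt //.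
  rewrite {1}TT mulmxBl mulmxDl -!scalemxAl mul1mx mulmxA JT mul0mx.
  have -> : K *m K *m (T *m T) = 0.
    have KT : K *m T = 0 by rewrite -[K]trmxK -Tt -trmx_mul Kt mulmxN TK oppr0 linear0.
    by rewrite -mulmxA [K *m (T *m T)]mulmxA KT mul0mx mulmx0.
  by rewrite scaler0 addr0 subr0 linearZ /= -(sqnorm_sym Tt) nmulr_rge0.
have SE' i j : A i j + A j i = a * (i == j)%:R + c.
  have := TE i j; rewrite T0 mxE; lra.
have [[i j] Kij] : exists ij, K ij.1 ij.2 != 0.
  apply/existsP; apply: contra_neqT K_neq0; rewrite negb_exists => /forallP h.
  by apply/matrixP => i j; rewrite mxE; have := h (i, j); rewrite negbK => /eqP.
have ij : i != j by apply: contra_neq Kij => /= ->; rewrite KE subrr.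
(* Where K is nonzero exactly one of the two opposite arcs is present, so the constant value of A +
   A^T off the diagonal is 1. *)
have c1 : c = 1.
  have := SE' i j; rewrite (negPf ij) mulr0 add0r => <-.
  move: Kij; rewrite /= KE AE !mxE.
  by case: (e i j); case: (e j i); rewrite ?subrr ?eqxx ?addr0 ?add0r.
by move=> i' j' ij'; rewrite SE' (negPf ij') c1 mulr0 add0r.
Qed.

(** The diagonal entry t of A ^ 2 counts the opposite pairs of arcs at a vertex: there are k of them
    if A is symmetric and none if A is a tournament. *)
Lemma proper_dsrg_not_normal : (0 < n)%N -> t != 0 -> t != k -> A *m At <> At *m A.
Proof.
move=> n_gt0 t0 tk /normal_sym_or_tournament A_cases; pose i := Ordinal n_gt0.
have AAii : (A *m A) i i = t by rewrite AA !mxE eqxx AE mxE e_irr mulr0n mulr1n; ring.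
have AAii_sum : (A *m A) i i = \sum_j A i j * A j i by rewrite mxE.
have A01 x y : A x y = 0 \/ A x y = 1.
  by rewrite AE mxE; case: (e x y); [right | left].
case: A_cases => [Asym | Atour].
  move/eqP: tk; apply; rewrite -AAii AAii_sum.
  have := congr1 (fun M : 'M[F]_n => M i i) AJ; rewrite !mxE mulr1 => <-.
  apply: eq_bigr => j _; rewrite mxE mulr1.
  have -> : A j i = A i j by rewrite -{1}Asym mxE.
  by case: (A01 i j) => ->; rewrite ?mulr0 ?mulr1.
move/eqP: t0; apply; rewrite -AAii AAii_sum big1 // => j _.
have [<-|ij] := eqVneq i j; first by rewrite AE mxE e_irr mul0r.
have := Atour i j ij.
by case: (A01 i j) => ->; case: (A01 j i) => ->; rewrite ?mulr0 ?mul0r //; lra.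
Qed.

End NormalDSRG.

(** * Six independent matrices built from a nonnormal square root of delta P *)

Section FreeCommutator.

Variables (F : realFieldType) (n : nat) (U : 'M[F]_n) (delta : F).
Local Notation J := (const_mx 1 : 'M[F]_n).
Local Notation P := (1%:M - n%:R^-1 *: J).
Local Notation V := U^T.
Hypothesis n_neq0 : n%:R != 0 :> F.
Hypotheses (UJ : U *m J = 0) (JU : J *m U = 0).
Hypothesis UU : U *m U = delta *: P.
Hypothesis U_nonnormal : U *m V != V *m U.
Hypothesis trU : \tr U != 0.

Local Notation C := (U *m V - V *m U).

Lemma trmx_mulJ : V *m J = 0.
Proof. by rewrite -[J]trmx_const -trmx_mul JU linear0. Qed.

Lemma mulJ_trmx : J *m V = 0.
Proof. by rewrite -[J]trmx_const -trmx_mul UJ linear0. Qed.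

Lemma proj_mulJ : P *m J = 0.
Proof. by rewrite mulmxBl mul1mx -scalemxAl mulmx_const1 scalerA mulVf // scale1r subrr. Qed.

Lemma proj_mull (M : 'M[F]_n) : J *m M = 0 -> P *m M = M.
Proof. by move=> JM; rewrite mulmxBl mul1mx -scalemxAl JM scaler0 subr0. Qed.

Lemma proj_mulr (M : 'M[F]_n) : M *m J = 0 -> M *m P = M.
Proof. by move=> MJ; rewrite mulmxBr mulmx1 -scalemxAr MJ scaler0 subr0. Qed.

Lemma trmx_sqr : V *m V = delta *: P.
Proof. by rewrite -trmx_mul UU linearZ linearB /= linearZ /= trmx1 trmx_const. Qed.

(** The terms U V U cancel in U C + C U, leaving U ^ 2 V - V U ^ 2; this is 0 because U ^ 2 = delta
    P and P acts as the identity on V. *)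
Lemma comm_anticommute : U *m C = - (C *m U).
Proof.
rewrite mulmxBr mulmxBl mulmxA UU -[V *m U *m U]mulmxA UU -scalemxAl -scalemxAr.
by rewrite proj_mull ?mulJ_trmx // proj_mulr ?trmx_mulJ // !mulmxA opprB.
Qed.

Lemma comm_anticommute_trmx : V *m C = - (C *m V).
Proof.
rewrite mulmxBr mulmxBl mulmxA [V *m (V *m U)]mulmxA trmx_sqr -[U *m V *m V]mulmxA trmx_sqr.
rewrite -scalemxAl -scalemxAr proj_mull // proj_mulr //.
by rewrite opprB.
Qed.

Lemma comm_trmx : C^T = C.
Proof. by rewrite linearB /= !trmx_mul trmxK. Qed.

Lemma comm_mulJ : C *m J = 0.
Proof. by rewrite mulmxBl -!mulmxA trmx_mulJ UJ !mulmx0 subrr. Qed.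

Lemma mulJ_comm : J *m C = 0.
Proof. by rewrite mulmxBr !mulmxA JU mulJ_trmx !mul0mx subrr. Qed.

Lemma commutator_free : free [:: P; U; V; C; J; C *m C].
Proof.
have anti_U := comm_anticommute; have anti_V := comm_anticommute_trmx.
have CJ := comm_mulJ; have JC := mulJ_comm.
have C_sym := comm_trmx; have CP := proj_mulr CJ; have PC := proj_mull JC.
have trC : \tr C = 0 by rewrite linearB /= mxtrace_mulC subrr.
have trUC : \tr (U *m C) = 0.
  rewrite mulmxBr linearB /= [\tr (U *m (V *m U))]mxtrace_mulC -mulmxA.
  by rewrite [\tr (V *m _)]mxtrace_mulC mulmxA subrr.
have D_neq0 : C != 0 by rewrite subr_eq0.
have [D DE] : exists D, D = C by exists C.
rewrite -DE in anti_U anti_V CJ JC C_sym CP PC trC trUC D_neq0 *.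
have trDD : \tr (D *m D) != 0.
  by rewrite -{2}C_sym; apply: contra_neq D_neq0; exact: sqnorm_eq0.
have trUDD : \tr (U *m (D *m D)) = 0.
  have h : \tr (U *m (D *m D)) = - \tr (U *m (D *m D)).
    by rewrite {1}mulmxA anti_U mulNmx linearN /= -mulmxA mxtrace_mulC -mulmxA.
  by move: h; lra.
apply/(@freeP _ _ 6 [tuple P; U; V; D; J; D *m D]) => q.
rewrite !big_ord_recl big_ord0 /=.
set al := q _; set be := q _; set ga := q _; set de := q _; set ep := q _; set ze := q _.
rewrite addr0 => qE.
(* Multiplication by J annihilates every term except the one in J. *)
have ep0 : ep = 0.
  have /eqP : (ep * n%:R) *: J = 0.
    have := congr1 (fun M => M *m J) qE; rewrite /= !mulmxDl.
    rewrite -!scalemxAl proj_mulJ UJ trmx_mulJ CJ.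
    by rewrite -mulmxA CJ mulmx0 mulmx_const1 mul0mx !scaler0 !add0r addr0 scalerA.
  rewrite scaler_eq0 mulf_eq0 (negPf n_neq0) orbF => /orP[/eqP // | /eqP J0].
  have trJ : \tr J = n%:R.
    by rewrite /mxtrace (eq_bigr (fun=> 1)) => [|i _]; rewrite ?mxE // sumr_const card_ord.
  by move: n_neq0; rewrite -trJ J0 linear0 eqxx.
have DDN0 : D *m D != 0 by apply: contra_neq trDD => ->; rewrite linear0.
move: qE; rewrite ep0 scale0r add0r => qE.
(* The relation is multiplied by D on the left and on the right. D commutes with P and D ^ 2 and
   anticommutes with U and V, so the difference isolates the terms in U and V. *)
have DLR : D *m (be *: U + ga *: V) = 0.
  have h1 := congr1 (fun M => D *m M) qE; have h2 := congr1 (fun M => M *m D) qE.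
  move: h1 h2; rewrite /= !mulmxDr !mulmxDl -!scalemxAr -!scalemxAl CP PC.
  rewrite anti_U anti_V mulmx0 mul0mx -mulmxA => /matrixP h1 /matrixP h2.
  apply/matrixP => i j; have := h1 i j; have := h2 i j.
  move: (D *m U) (D *m V) (D *m D) (D *m (D *m D)) => X Y Z W.
  by rewrite !mxE; lra.
(* [DLR] is multiplied by U on either side and the results are added: the terms in U ^ 2 cancel,
   leaving ga D (V U - U V) = - ga D ^ 2. *)
have ga0 : ga = 0.
  have h1 : U *m (D *m (be *: U + ga *: V)) = 0 by rewrite DLR mulmx0.
  have h2 : D *m (be *: U + ga *: V) *m U = 0 by rewrite DLR mul0mx.
  have /eqP : ga *: (D *m D) = 0.
    rewrite {2}DE mulmxBr; move: h1 h2.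
    rewrite [U *m (D *m _)]mulmxA anti_U mulNmx -[D *m U *m _]mulmxA !mulmxDr !mulmxDl.
    rewrite -!scalemxAr -!scalemxAl UU mulmxA -!scalemxAr CP.
    rewrite -![D *m _ *m U]mulmxA UU -scalemxAr CP => /matrixP h1 /matrixP h2.
    apply/matrixP => i j; have := h1 i j; have := h2 i j.
    move: (D *m (U *m V)) (D *m (V *m U)) => X Y.
    by rewrite !mxE; lra.
  by rewrite scaler_eq0 (negPf DDN0) orbF => /eqP.
(* Otherwise D U = 0, and then D ^ 2 = - D V U = V D U = 0. *)
have be0 : be = 0.
  move: DLR; rewrite ga0 scale0r addr0 -scalemxAr => /eqP.
  rewrite scaler_eq0 => /orP[/eqP // | /eqP DU].
  case/eqP: DDN0; rewrite {2}DE mulmxBr !mulmxA DU mul0mx sub0r.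
  by rewrite -[D *m V]opprK -anti_V mulNmx -mulmxA DU mulmx0 !oppr0.
move: qE; rewrite be0 ga0 !scale0r !add0r => qE.
(* After multiplication by U, only the term in P has a nonzero trace, namely tr U. *)
have al0 : al = 0.
  have := congr1 (fun M => \tr (U *m M)) qE.
  rewrite /= !mulmxDr -!scalemxAr proj_mulr // mulmx0 !linearD !linearZ /= trUC trUDD.
  by rewrite linear0 !mulr0 !addr0 => /eqP; rewrite mulf_eq0 (negPf trU) orbF => /eqP.
move: qE; rewrite al0 scale0r add0r => qE.
have ze0 : ze = 0.
  have := congr1 mxtrace qE; rewrite /= linearD !linearZ /= trC linear0 mulr0 add0r.
  by move/eqP; rewrite mulf_eq0 (negPf trDD) orbF => /eqP.
have de0 : de = 0.
  move/eqP: qE; rewrite ze0 scale0r addr0 scaler_eq0 (negPf D_neq0) orbF.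
  by move/eqP.
by case=> -[|[|[|[|[|[|]]]]]] // lt;
  [rewrite -al0 | rewrite -be0 | rewrite -ga0 | rewrite -de0 | rewrite -ep0 | rewrite -ze0];
  congr (q _); apply: val_inj.
Qed.

End FreeCommutator.

(** * Dimension of an algebra containing a proper DSRG *)

Section DSRGAlgebra.

Variables (F : realFieldType) (n : nat) (e : rel 'I_n) (A : 'M[F]_n).
Variables (k t lam mu : nat).
Hypothesis n_gt0 : (0 < n)%N.
Hypothesis AE : A = \matrix_(i, j) (e i j)%:R.
Hypothesis e_irr : irreflexive e.
Local Notation J := (const_mx 1 : 'M[F]_n).
Local Notation Id := (1%:M : 'M[F]_n).
Hypotheses (AJ : A *m J = k%:R *: J) (JA : J *m A = k%:R *: J).
Hypothesis AA : A *m A = t%:R *: Id + lam%:R *: A + mu%:R *: (J - Id - A).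
Hypothesis t_bounds : (0 < t < k)%N.

Local Notation At := A^T.

Lemma dsrg_not_normal : A *m At <> At *m A.
Proof.
have n0 : n%:R != 0 :> F by rewrite pnatr_eq0 -lt0n.
case/andP: t_bounds => t0 tk.
apply: (@proper_dsrg_not_normal _ _ e A k%:R t%:R lam%:R mu%:R) => //.
  by rewrite pnatr_eq0 -lt0n.
by rewrite eqr_nat; move: tk; rewrite ltn_neqAle => /andP[].
Qed.

Lemma dsrg_valency_lt : (k < n)%N.
Proof.
pose i := Ordinal n_gt0.
have := congr1 (fun M : 'M[F]_n => M i i) AJ; rewrite !mxE mulr1.
rewrite (eq_bigr (fun j => (e i j)%:R)) => [|j _]; last by rewrite AE !mxE mulr1.
rewrite -natr_sum => /eqP; rewrite eqr_nat => /eqP <-.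
rewrite (bigD1 i) //= e_irr add0n -[X in (_ < X)%N]card_ord (cardD1 i) inE add1n ltnS.
rewrite -sum1_card big_mkcond [X in (_ <= X)%N]big_mkcond /=; apply: leq_sum => j _.
by rewrite !inE andbT; case: (j == i); case: (e i j).
Qed.

(** Counts the walks of length two from a vertex, with the term mu (k + 1) moved to the left to
    avoid subtraction. *)
Lemma dsrg_count : (k * k + mu * k.+1 = t + lam * k + mu * n)%N.
Proof.
pose i := Ordinal n_gt0.
have : A *m A *m J = (k * k)%:R *: J.
  by rewrite -mulmxA AJ -scalemxAr AJ scalerA natrM.
rewrite AA !mulmxDl -!scalemxAl !mulmxDl !mulNmx mul1mx AJ mulmx_const1 => /matrixP/(_ i i).
rewrite !mxE => h; apply/eqP; rewrite -(eqr_nat F) !natrD !natrM -natr1; apply/eqP.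
by move: h; rewrite !natrM; lra.
Qed.

(** This is tr U != 0 for the matrix U of [dsrg_algebra_dim]. Equality together with [dsrg_count]
    would make k divide t, although 0 < t < k. *)
Lemma dsrg_trace_neq0 : (mu%:R - lam%:R) * (n%:R - 1) != 2 * k%:R :> F.
Proof.
apply/eqP => h; have kn := dsrg_valency_lt; have kE := dsrg_count.
have hN : (mu * n.-1 = lam * n.-1 + 2 * k)%N.
  move: h; rewrite -{1}(prednK n_gt0) -natr1 addrK => h.
  by apply/eqP; rewrite -(eqr_nat F) natrD !natrM; apply/eqP; lra.
case/andP: t_bounds => t0 tk.
suff [x tE] : exists x, (t + x * k = k * k)%N.
  have : (k %| t)%N by rewrite -(dvdn_addl t (dvdn_mull x (dvdnn k))) tE dvdn_mulr.
  by move=> /(dvdn_leq t0); rewrite leqNgt tk.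
have [m nE] : exists m, n = m.+1 by exists n.-1; rewrite prednK.
move: hN kn kE; rewrite nE /= => hN kn kE.
have [lt_mu|] := ltnP lam mu; last by nia.
have [d muE] : exists d, mu = (lam + d.+1)%N by exists (mu - lam).-1; lia.
(* Since 0 < k <= n - 1, equality leaves mu - lam = 1 with n - 1 = 2 k, or mu - lam = 2 with n - 1 =
   k. *)
case: d muE => [|[|d]] muE; last by nia.
  by exists (lam + mu)%N; nia.
by exists lam; nia.
Qed.

Lemma dsrg_algebra_dim (W : {vspace 'M[F]_n}) :
  (forall M N, M \in W -> N \in W -> M *m N \in W) ->
  Id \in W -> J \in W -> A \in W -> At \in W -> (5 < \dim W)%N.
Proof.
move=> Wmul WI WJ WA WAt.
have n0 : n%:R != 0 :> F by rewrite pnatr_eq0 -lt0n.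
pose a : F := lam%:R - mu%:R; pose b : F := t%:R - mu%:R.
pose c : F := (2 * k%:R - a) / n%:R.
pose U := 2 *: A - a *: Id - c *: J.
have AtJ := dsrg_trmx_mulJ JA; have JAt := dsrg_mulJ_trmx AJ.
have UJ : U *m J = 0.
  rewrite !mulmxBl -!scalemxAl AJ mul1mx mulmx_const1 /c; move: J => J0.
  by apply/matrixP => i j; rewrite !mxE; field.
have JU : J *m U = 0.
  rewrite !mulmxBr -!scalemxAr JA mulmx1 mulmx_const1 /c; move: J => J0.
  by apply/matrixP => i j; rewrite !mxE; field.
have Ut : U^T = 2 *: At - a *: Id - c *: J.
  by rewrite /U !linearB !linearZ /= trmx1 trmx_const.
have JUt : J *m U^T = 0 by rewrite -[J]trmx_const -trmx_mul UJ linear0.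
have AA' := dsrg_sqr AA; rewrite -/a -/b in AA'.
have [u UU] : exists u, U *m U = (a ^+ 2 + 4 * b) *: Id + u *: J.
  exists (4 * mu%:R + a * c - 2 * c * k%:R).
  rewrite {1}/U !mulmxBl -!scalemxAl JU mul1mx /U !mulmxBr -!scalemxAr.
  rewrite AA' AJ mulmx1; move: Id J => I0 J0; mxlin.
(* The coefficient u is determined by multiplying by J, which U annihilates. *)
have {}UU : U *m U = (a ^+ 2 + 4 * b) *: (Id - n%:R^-1 *: J).
  have : U *m U *m J = 0 by rewrite -mulmxA UJ mulmx0.
  rewrite UU mulmxDl -!scalemxAl mul1mx mulmx_const1 => /matrixP h.
  have {}h : (a ^+ 2 + 4 * b) + u * n%:R = 0.
    by have := h (Ordinal n_gt0) (Ordinal n_gt0); rewrite !mxE !mulr1.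
  have -> : u = - (a ^+ 2 + 4 * b) / n%:R.
    by apply: (mulIf n0); rewrite divfK //; lra.
  by move: Id J => I0 J0; mxlin.
have U_nonnormal : U *m U^T != U^T *m U.
  apply/eqP => UN; apply: dsrg_not_normal; move: UN.
  rewrite {1}/U [in RHS]Ut !mulmxBl -!scalemxAl JU JUt !mul1mx Ut /U.
  rewrite !mulmxBr -!scalemxAr !mulmx1 AJ AtJ => /matrixP h; apply/matrixP => i j.
  have := h i j; move: (A *m At) (At *m A) => X Y; rewrite !mxE.
  by move: (_ *+ (i == j)) => ?; lra.
have trU : \tr U != 0.
  have trA : \tr A = 0 by rewrite /mxtrace big1 // => i _; rewrite AE mxE e_irr.
  have trJ : \tr J = n%:R.
    by rewrite /mxtrace (eq_bigr (fun=> 1)) => [|i _]; rewrite ?mxE // sumr_const card_ord.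
  rewrite /U !linearB !linearZ /= trA trJ mxtrace1 /c.
  have := dsrg_trace_neq0; apply: contra => /eqP h; apply/eqP; move: h.
  by rewrite divfK // /a; lra.
have sub_dim := dimvS (_ : (<<[:: Id - n%:R^-1 *: J; U; U^T; U *m U^T - U^T *m U; J;
  (U *m U^T - U^T *m U) *m (U *m U^T - U^T *m U)]>> <= W)%VS).
have free6 := commutator_free n0 UJ JU UU U_nonnormal trU.
move: free6 sub_dim; rewrite /free => /eqP -> /=; apply.
have WU : U \in W by rewrite !rpredB ?rpredZ.
have WUt : U^T \in W by rewrite Ut !rpredB ?rpredZ.
have WC : U *m U^T - U^T *m U \in W by rewrite rpredB ?Wmul.
apply/span_subvP => M; rewrite !inE.
by do ![case/orP] => /eqP ->; rewrite ?rpredB ?rpredZ ?Wmul.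
Qed.

End DSRGAlgebra.

(** * Association schemes containing a proper DSRG *)

Section SchemeRank.

Variables (V : finType) (e : rel V) (v k t lam mu : nat).
Variables (X : {set {set V * V}}).

Lemma map_adjmx (K : pzRingType) : map_mx intr (adjmx int e) = adjmx K e.
Proof. by apply/matrixP => i j; rewrite !mxE rmorph_nat. Qed.

Lemma dsrg_map (K : fieldType) : is_dsrg e v k t lam mu ->
  let A := adjmx K e in let J := const_mx 1 : 'M[K]_#|V| in
  [/\ A *m J = k%:R *: J, J *m A = k%:R *: J
    & A *m A = t%:R *: 1%:M + lam%:R *: A + mu%:R *: (J - 1%:M - A)].
Proof.
move=> [_ _ [AJ JA] AA] A J.
have mapJ : map_mx intr (const_mx 1 : 'M[int]_#|V|) = J :> 'M[K]_#|V|.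
  by rewrite map_const_mx.
have intrn m : (m%:R : int)%:~R = m%:R :> K by rewrite rmorph_nat.
have mapK := congr1 (map_mx (intr : int -> K)).
move: (mapK _ _ _ _ AJ) (mapK _ _ _ _ JA) (mapK _ _ _ _ AA).
rewrite !map_mxM !map_mxD !map_mxZ map_scalar_mx !map_mxB map_mx1 mapJ map_adjmx.
by rewrite /= !intrn scalemx1.
Qed.

Lemma homogeneous_card_gt0 : is_association_scheme X -> (0 < #|V|)%N.
Proof.
move=> [[/and3P[_ _ X0] _ _ _] diagX]; rewrite lt0n; apply: contraNneq X0 => V0.
rewrite (_ : set0 = diagonal V) //; apply/setP => [[x y]].
by have := fintype0 x V0.
Qed.

Lemma adj_span_mul (K : fieldType) (M N : 'M[K]_#|V|) : is_coherent X ->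
  M \in adj_span K X -> N \in adj_span K X -> M *m N \in adj_span K X.
Proof.
move=> cohX; have [pX _ _ _] := cohX; rewrite !adj_spanP // => cM cN.
move=> s sX x y x' y' h h'; rewrite !mxfunM.
exact: (class_constant_mul cohX cM cN sX h h').
Qed.

Lemma dim_adj_span (K : fieldType) : (\dim (adj_span K X) <= #|X|)%N.
Proof. by apply: leq_trans (dim_span _) _; rewrite size_map -cardE. Qed.

Lemma adj_span_trmx (K : fieldType) (M : 'M[K]_#|V|) : is_coherent X ->
  M \in adj_span K X -> M^T \in adj_span K X.
Proof.
move=> cohX; have [pX _ _ _] := cohX; rewrite !adj_spanP // => cM.
move=> s sX x y x' y' h h'; rewrite /mxfun !mxE.
exact: (class_constant_converse cohX cM sX h h').
Qed.

Lemma class_constant_cover (S : {set {set V * V}}) : partition X [set: V * V] ->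
  S \subset X -> arcs e = cover S -> class_constant X e.
Proof.
move=> pX SX eS s sX.
suff sub x y x' y' : (x, y) \in s -> (x', y') \in s -> e x y -> e x' y'.
  by move=> x y x' y' h h'; apply/idP/idP; apply: sub.
move=> h h' exy; have : (x, y) \in arcs e by rewrite inE.
rewrite eS => /bigcupP[r rS xyr].
have rs : r = s by apply: class_eq pX _ sX xyr h; apply: (subsetP SX).
have : (x', y') \in arcs e by rewrite eS; apply/bigcupP; exists r => //; rewrite rs.
by rewrite inE.
Qed.

(** The algebra contains A and its transpose, which do not commute; this is known over the rationals
    and passes to [R[i]] because both products have integer entries. The rank is at least the
    dimension of the rational span. *)
Lemma proper_dsrg_scheme (R : realType) :
  is_proper_dsrg e v k t lam mu -> is_association_scheme X ->
  class_constant X e -> noncommutative R X /\ (6 <= #|X|)%N.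
Proof.
move=> [dsrg t_bounds] schemeX e_const.
have [cohX _] := schemeX; have [pX _ _ _] := cohX.
have V_gt0 := homogeneous_card_gt0 schemeX.
have e_irr : irreflexive (fun i j : 'I_#|V| => e (enum_val i) (enum_val j)).
  by case: dsrg => e_irr _ _ _ i; exact: e_irr.
have AE : adjmx rat e = \matrix_(i, j) (e (enum_val i) (enum_val j))%:R by [].
have [AJ JA AA] := dsrg_map rat dsrg.
have Ain (K : fieldType) : adjmx K e \in adj_span K X by apply/adj_span_adjmx.
split.
  move=> comm; have := comm _ _ (Ain _) (adj_span_trmx cohX (Ain _)).
  rewrite -map_adjmx map_trmx -!map_mxM => eqR.
  apply: (dsrg_not_normal V_gt0 AE e_irr AJ JA AA t_bounds).
  rewrite -map_adjmx map_trmx -!map_mxM; congr (map_mx _ _).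
  apply/matrixP => i j; apply: (@intr_inj R[i]).
  by have /matrixP/(_ i j) := eqR; rewrite !mxE.
apply: leq_trans (dim_adj_span rat).
apply: (dsrg_algebra_dim V_gt0 AE e_irr AJ JA AA t_bounds).
- by move=> M N; exact: adj_span_mul.
- apply/adj_spanP => // s sX x y x' y' h h'; rewrite /mxfun !mxE.
  rewrite !(inj_eq enum_rank_inj); congr (_%:R : rat).
  by congr nat_of_bool; exact: (class_constant_diag cohX sX h h').
- by apply/adj_spanP => // s sX x y x' y' h h'; rewrite /mxfun !mxE.
- exact: Ain.
- exact: (adj_span_trmx cohX (Ain _)).
Qed.

End SchemeRank.

(** * Primes congruent to 5 modulo 8 *)

Section InfinitelyManyPrimes.

Local Open Scope nat_scope.

(** n / 2 is a square root of -1 modulo q, and q is odd because n is; Fermat then makes (q - 1) / 2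
    even. *)
Lemma prime_dvd_sqrD4 q n : prime q -> odd n -> q %| n ^ 2 + 4 -> q %% 4 = 1.
Proof.
move=> q_pr n_odd qn.
have q_odd : odd q.
  by apply: (dvdn_odd qn); rewrite oddD oddX n_odd.
have two0 : (2%:R != 0 :> 'F_q)%R.
  rewrite -(dvdn_pcharf (pchar_Fp q_pr)) dvdn_prime2 //.
  by apply: contraTneq q_odd => ->.
pose x : 'F_q := (n%:R / 2%:R)%R.
have x2 : (x ^+ 2 = -1)%R.
  have /eqP : ((n ^ 2 + 4)%:R = 0 :> 'F_q)%R.
    by apply/eqP; rewrite -(dvdn_pcharf (pchar_Fp q_pr)).
  rewrite natrD natrX addr_eq0 /x expr_div_n => /eqP ->.
  have -> : (4%:R = 2%:R ^+ 2 :> 'F_q)%R by rewrite -natrX.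
  by rewrite mulNr divff // expf_neq0.
have x0 : (x != 0)%R.
  by apply: contra_eq_neq x2 => ->; rewrite expr0n eq_sym oppr_eq0 oner_eq0.
have xq : (x ^+ q.-1 = 1)%R.
  apply: (mulfI x0); rewrite mulr1 -exprS prednK ?prime_gt0 //.
  by rewrite -[RHS]expf_card card_Fp.
have q1 : q.-1 = 2 * (q.-1)./2 by have := odd_double_half q; rewrite q_odd; lia.
have {xq} : ((-1) ^+ odd (q.-1)./2 = 1 :> 'F_q)%R by rewrite signr_odd -x2 -exprM -q1.
case: (boolP (odd _)) => [_ /eqP | h _]; last first.
  by have := odd_double_half (q.-1)./2; rewrite (negPf h); have := prime_gt0 q_pr; lia.
by rewrite expr1 eq_sym -subr_eq0 opprK -[(1 + 1)%R]/(2%:R)%R (negPf two0).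
Qed.

Lemma mod8_eq1 m : 0 < m -> (forall q, prime q -> q %| m -> q %% 8 = 1) -> m %% 8 = 1.
Proof.
elim/ltn_ind: m => m IHm m_gt0 m_pr; have [m_gt1 | m_le1] := ltnP 1 m; last first.
  by have -> : m = 1 by lia.
have pdiv_pr := pdiv_prime m_gt1; have pdiv_m := pdiv_dvd m.
have div1 : (m %/ pdiv m) %% 8 = 1.
  apply: IHm; first by rewrite ltn_Pdiv // prime_gt1.
    by rewrite divn_gt0 ?pdiv_gt0 // dvdn_leq.
  by move=> q q_pr qm; apply: m_pr => //; exact: dvdn_trans qm (dvdn_div pdiv_m).
by rewrite -(divnK pdiv_m) -modnMm (m_pr _ pdiv_pr pdiv_m) div1.
Qed.

(** For odd n the prime divisors of n ^ 2 + 4 are 1 modulo 4. As n ^ 2 + 4 is 5 modulo 8, they are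
    not all 1 modulo 8, so one of them is 5. *)
Lemma szekeres_primes_infinite N : exists2 p, N < p & szekeres_prime p.
Proof.
pose n := \prod_(i < N + 13) (2 * i + 1).
have n_odd : odd n.
  rewrite /n; elim/big_ind: _ => // [x y|i _]; first by rewrite oddM => -> ->.
  by rewrite addn1 mul2n /= odd_double.
have n_mod8 : (n ^ 2 + 4) %% 8 = 5.
  have [k ->] : exists k, n = 2 * k + 1.
    by exists n./2; have := odd_double_half n; rewrite n_odd; lia.
  have [j kj] : exists j, k * k.+1 = 2 * j.
    exists (k * k.+1)./2; have := odd_double_half (k * k.+1).
    by rewrite oddM /=; case: (odd k) => /=; lia.
  have -> : (2 * k + 1) ^ 2 + 4 = j * 8 + 5 by rewrite -mulnn; nia.
  by rewrite modnMDl.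
have [q q_pr [qn q8]] : exists2 q, prime q & q %| n ^ 2 + 4 /\ q %% 8 = 5.
  have /allPn[q] : ~~ all (fun q => q %% 8 == 1) (primes (n ^ 2 + 4)).
    apply/negP => /allP h; suff : (n ^ 2 + 4) %% 8 = 1 by rewrite n_mod8.
    apply: mod8_eq1 => [|q q_pr qn]; first by rewrite addn_gt0 orbT.
    by apply/eqP/h; rewrite mem_primes q_pr qn addn_gt0 orbT.
  rewrite mem_primes => /and3P[q_pr _ qn] /eqP q1; exists q => //; split=> //.
  have := prime_dvd_sqrD4 q_pr n_odd qn; lia.
have q_gt : N + 13 < q.
  rewrite ltnNge; apply/negP => q_le.
  (* An odd q <= N + 13 is the factor of n with index q / 2; it would then divide 4. *)
  have qdvdn : q %| n.
    have lt_q : q./2 < N + 13 by have := odd_double_half q; have := prime_gt0 q_pr; lia.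
    rewrite /n (bigD1 (Ordinal lt_q)) //= (_ : 2 * q./2 + 1 = q) ?dvdn_mulr //.
    by have := odd_double_half q; lia.
  have : q %| 4 by rewrite -(dvdn_addr 4 (dvdn_exp (isT : 0 < 2) qdvdn)).
  by move=> /(dvdn_leq (isT : 0 < 4)); lia.
by exists q; [lia | split=> //; lia].
Qed.

End InfinitelyManyPrimes.

(** * The coherent closure of Gamma *)

Section SignCounts.

Variable p : nat.
Hypotheses (p_pr : prime p) (p_mod8 : (p %% 8 = 5)%N).
Implicit Types (u v w : szekeres_vertex p) (sg ta ka : int).

(** Interpolation coefficients on the values 0, 1, -1: twice the indicator of a sign is an affine
    combination of 1, the identity and [szsign]. *)
Definition scoef1 sg : int := (sg ^+ 2 == 1)%:R.
Definition scoef_diag sg : int := (sg == 0)%:R * 2 - scoef1 sg.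
Definition scoef_sign sg : int := sg * scoef1 sg.

Lemma sign_cases u v : [\/ szsign u v = 0, szsign u v = 1 | szsign u v = -1].
Proof.
have := szsign_sqr p_pr p_mod8 u v; case: (u == v) => /eqP.
  by rewrite sqrf_eq0 => /eqP; constructor.
by rewrite sqrf_eq1 => /orP[] /eqP; [constructor 2 | constructor 3].
Qed.

Lemma szsign_eq0 u v : (szsign u v == 0) = (u == v).
Proof.
by rewrite -sqrf_eq0 szsign_sqr //; case: (u == v).
Qed.

Lemma sign_indicator sg u v : 2 * (szsign u v == sg)%:R =
  scoef1 sg + scoef_diag sg * (u == v)%:R + scoef_sign sg * szsign u v :> int.
Proof.
rewrite -szsign_eq0 /scoef_sign /scoef_diag /scoef1 sqrf_eq1.
by case: (sign_cases u v) => ->; rewrite ?eqxx ![_ == sg]eq_sym;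
  do 3?[case: eqP => [->|] //=]; lia.
Qed.

(* The product of two indicators as in [sign_indicator], summed with the help of
   [sum_szsign] and [szsign_orth]; [ka] is the sign of the pair of end points. *)
Definition sign_count sg ta ka : int :=
  scoef1 sg * scoef1 ta * (2 * p%:Z + 1) + scoef1 sg * scoef_diag ta
  + scoef_diag sg * scoef1 ta + scoef_diag sg * scoef_diag ta * (ka == 0)%:R
  + (scoef_diag sg * scoef_sign ta + scoef_sign sg * scoef_diag ta) * ka
  + scoef_sign sg * scoef_sign ta * (1 - (2 * p%:Z + 1) * (ka == 0)%:R).

Lemma sum_signs sg ta u w :
  4 * \sum_v ((szsign u v == sg)%:R * (szsign v w == ta)%:R) =
  sign_count sg ta (szsign u w).
Proof.
rewrite mulr_sumr; transitivity (\sum_v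
    (scoef1 sg + scoef_diag sg * (u == v)%:R + scoef_sign sg * szsign u v) *
    (scoef1 ta + scoef_diag ta * (v == w)%:R + scoef_sign ta * szsign v w)).
  apply: eq_bigr => v _; rewrite -!sign_indicator; ring.
have delta_l (h : szekeres_vertex p -> int) : \sum_v (u == v)%:R * h v = h u.
  by rewrite (bigD1 u) //= eqxx mul1r big1 ?addr0 // => v vu; rewrite eq_sym (negPf vu) mul0r.
have delta_r (h : szekeres_vertex p -> int) : \sum_v (v == w)%:R * h v = h w.
  by rewrite (bigD1 w) //= eqxx mul1r big1 ?addr0 // => v vu; rewrite (negPf vu) mul0r.
have sum1 : \sum_(v : szekeres_vertex p) 1 = 2 * p%:Z + 1 :> int.
  by rewrite (sumr_const predT) card_szekeres_vertex // natz; lia.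
have sum_s : \sum_v szsign u v = 0 by apply: sum_szsign.
have sum_s' : \sum_v szsign v w = 0.
  transitivity (- \sum_v szsign w v); last by rewrite sum_szsign ?oppr0.
  by rewrite -sumrN; apply: eq_bigr => v _; rewrite szsignC.
have orth : \sum_v szsign u v * szsign v w = 1 - (2 * p%:Z + 1) * (szsign u w == 0)%:R.
  have := szsign_orth p_pr p_mod8 u w; rewrite szsign_eq0 => h.
  transitivity (- \sum_v szsign u v * szsign w v); last by rewrite h; ring.
  by rewrite -sumrN; apply: eq_bigr => v _; rewrite (szsignC _ _ w) // mulrN.
pose c1 := scoef1; pose cd := scoef_diag; pose cs := scoef_sign.
rewrite (eq_bigr (fun v => c1 sg * c1 ta * 1 + c1 sg * cd ta * (v == w)%:R
  + c1 sg * cs ta * szsign v w + cd sg * c1 ta * (u == v)%:R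
  + cd sg * cd ta * ((u == v)%:R * (v == w)%:R)
  + cd sg * cs ta * ((u == v)%:R * szsign v w) + cs sg * c1 ta * szsign u v
  + cs sg * cd ta * ((v == w)%:R * szsign u v)
  + cs sg * cs ta * (szsign u v * szsign v w))); last first.
  by move=> v _; rewrite -/c1 -/cd -/cs; ring.
rewrite !big_split /= -!mulr_sumr sum1 sum_s sum_s' orth !delta_l delta_r.
have -> : \sum_v (v == w)%:R = 1 :> int.
  by rewrite -[RHS](delta_r (fun=> 1)); apply: eq_bigr => v _; rewrite mulr1.
have -> : \sum_v (u == v)%:R = 1 :> int.
  by rewrite -[RHS](delta_l (fun=> 1)); apply: eq_bigr => v _; rewrite mulr1.
by rewrite /sign_count szsign_eq0 -/c1 -/cd -/cs; ring.
Qed.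

(** Negating all three signs corresponds to reversing every arc, and the coefficients linear in the
    sign occur only in pairs or together with [ka]. *)
Lemma sign_count_twist eta sg ta ka : eta ^+ 2 = 1 ->
  sign_count (eta * sg) (eta * ta) (eta * ka) = sign_count sg ta ka.
Proof.
move=> eta2; have eta0 : eta != 0 by apply: contra_eq_neq eta2 => ->.
have c1E x : scoef1 (eta * x) = scoef1 x by rewrite /scoef1 exprMn eta2 mul1r.
have cdE x : scoef_diag (eta * x) = scoef_diag x.
  by rewrite /scoef_diag c1E mulf_eq0 (negPf eta0).
have csE x : scoef_sign (eta * x) = eta * scoef_sign x by rewrite /scoef_sign c1E mulrA.
rewrite /sign_count !c1E !cdE !csE mulf_eq0 (negPf eta0) /=.
by move/eqP: eta2; rewrite sqrf_eq1 => /orP[] /eqP ->; ring.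
Qed.

End SignCounts.

(** * Colours of the pairs of vertices of Gamma *)

Section GammaScheme.

Variable p : nat.
Hypotheses (p_pr : prime p) (p_mod8 : (p %% 8 = 5)%N).
Local Notation V := (Gamma_vertex p).
Implicit Types (x y z : V) (u v w : szekeres_vertex p).

Definition base x : szekeres_vertex p := match x with inl u | inr u => u end.
Definition side x : bool := if x is inl _ then false else true.
Definition twist (c : bool) : int := (-1) ^+ c.
(** The sign is twisted by the copy of the second vertex, as the columns of the second block carry
    the transpose of B; thus arcs are the pairs of sign 1. With the bit telling whether the copies
    differ there are six colours. *)
Definition tsign x y : int := twist (side y) * szsign (base x) (base y).
Definition colour x y : bool * int := (side x (+) side y, tsign x y).
Definition colour_class (c : bool * int) : {set V * V} :=
  [set xy | colour xy.1 xy.2 == c].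
Definition Gamma_classes : {set {set V * V}} :=
  [set colour_class (colour xy.1 xy.2) | xy : V * V].

Lemma vertex_eq x y : (x == y) = (side x == side y) && (base x == base y).
Proof. by case: x y => [u|u] [w|w]. Qed.

Lemma twist_sqr c : twist c ^+ 2 = 1.
Proof. by case: c. Qed.

Lemma GammaE_tsign x y : Gamma p x y = (tsign x y == 1).
Proof.
case: x y => [u|u] [w|w]; rewrite /Gamma /tsign /twist /= ?expr0 ?expr1 ?mul1r ?mulN1r;
by rewrite szekeresE // szsignC.
Qed.

Lemma tsignC x y : tsign y x = - twist (side x (+) side y) * tsign x y.
Proof.
rewrite /tsign (szsignC p_pr p_mod8 (base x)).
by case: (side x); case: (side y); rewrite /twist /=; ring.
Qed.

Lemma tsign_cases x y : [\/ tsign x y = 0, tsign x y = 1 | tsign x y = -1].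
Proof.
rewrite /tsign /twist; case: (sign_cases p_pr p_mod8 (base x) (base y)) => ->;
  case: (side y); first [by constructor 1 | by constructor 2 | by constructor 3].
Qed.

Lemma tsign_eq0 x y : (tsign x y == 0) = (base x == base y).
Proof. by rewrite /tsign mulf_eq0 szsign_eq0 // /twist signr_eq0. Qed.

Lemma sum_Gamma_vertex (h : V -> int) :
  \sum_z h z = \sum_v h (inl v) + \sum_v h (inr v).
Proof. exact: big_sumType. Qed.

(** At most one copy can contain z, and on it the count reduces to [sum_signs]; the twist by
    [side y], common to all three signs, drops out. Hence the count depends only on the colour of
    (x, y). *)
Lemma sum_colour c d x y :
  4 * \sum_z ((colour x z == c)%:R * (colour z y == d)%:R) =
  (side x (+) side y == c.1 (+) d.1)%:R *
  sign_count p (twist d.1 * c.2) d.2 (tsign x y).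
Proof.
have layerE b : \sum_v ((colour x (if b then inr v else inl v) == c)%:R *
    (colour (if b then inr v else inl v) y == d)%:R) =
    ((side x (+) b == c.1) && (b (+) side y == d.1))%:R *
    \sum_v ((szsign (base x) v == twist b * c.2)%:R *
    (szsign v (base y) == twist (side y) * d.2)%:R) :> int.
  rewrite mulr_sumr; apply: eq_bigr => v _; rewrite -!pair_eqE /= /pair_eq /=.
  have tw_eq a s t : (twist a * s == t) = (s == twist a * t).
    by rewrite -{1}[t]mul1r -(twist_sqr a) expr2 -mulrA (inj_eq (mulfI _)) // signr_eq0.
  by rewrite /tsign; case: b => /=; rewrite !tw_eq -!mulnb !natrM; ring.
rewrite sum_Gamma_vertex (layerE false) (layerE true) mulrDr.
rewrite ![4 * (_ * _)]mulrCA !sum_signs //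
  -[in RHS](sign_count_twist _ _ _ _ (twist_sqr (side y))).
rewrite [twist _ * tsign _ _]mulrA -expr2 twist_sqr mul1r.
case: c d {layerE} => [c1 c2] [d1 d2] /=.
by case: (side x); case: (side y); case: c1; case: d1;
  rewrite /twist /= ?mul0r ?add0r ?addr0 ?expr0 ?expr1 ?mul1r ?mulN1r ?opprK.
Qed.

End GammaScheme.

(** * Coherence of the colour classes *)

Section GammaCoherent.

Variable p : nat.
Hypotheses (p_pr : prime p) (p_mod8 : (p %% 8 = 5)%N).
Local Notation V := (Gamma_vertex p).
Implicit Types (x y z : V) (u v w : szekeres_vertex p).
Local Notation X := (Gamma_classes p).

Lemma mem_colour_class c x y : ((x, y) \in colour_class p c) = (colour x y == c).
Proof. by rewrite inE. Qed.

Lemma Gamma_classesP r :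
  reflect (exists x, exists y, r = colour_class p (colour x y)) (r \in X).
Proof.
apply: (iffP imsetP) => [[[x y] _ ->] | [x [y ->]]]; first by exists x, y.
by exists (x, y).
Qed.

Lemma Gamma_classes_partition : partition X [set: V * V].
Proof.
rewrite (_ : X = preim_partition (fun xy => colour xy.1 xy.2) [set: V * V]).
  exact: preim_partitionP.
apply/setP => r; apply/imsetP/imsetP => [] [xy _ ->]; exists xy => //;
by apply/setP => x'y'; rewrite !inE /= eq_sym.
Qed.

Lemma Gamma_class_constant (T : Type) (M : V -> V -> T) :
  (forall x y x' y', colour x y = colour x' y' -> M x y = M x' y') ->
  class_constant X M.
Proof.
move=> cM s /Gamma_classesP[a [b ->]] x y x' y'.
by rewrite !mem_colour_class => /eqP h /eqP h'; apply: cM; rewrite h h'.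
Qed.

Lemma diagonal_colour : diagonal V = colour_class p (false, 0).
Proof.
apply/setP => [[x y]]; rewrite mem_colour_class inE /= vertex_eq xpair_eqE.
by rewrite tsign_eq0 // -negb_add eqbF_neg.
Qed.

Lemma diagonal_class : diagonal V \in X.
Proof.
rewrite diagonal_colour; apply/Gamma_classesP; exists (inl None), (inl None).
by rewrite /colour /tsign szsign_diag // mulr0.
Qed.

Lemma card_colour_pairs c d x y x' y' : colour x y = colour x' y' ->
  #|[set z | (colour x z == c) && (colour z y == d)]| =
  #|[set z | (colour x' z == c) && (colour z y' == d)]|.
Proof.
move=> xy; apply/eqP; rewrite -(eqr_nat int).
have cardE a b : #|[set z | (colour a z == c) && (colour z b == d)]|%:R =
    \sum_z ((colour a z == c)%:R * (colour z b == d)%:R) :> int.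
  rewrite -sum1_card natr_sum big_mkcond; apply: eq_bigr => z _.
  by rewrite inE; case: (colour a z == c); case: (colour z b == d).
have four0 : (4 : int) != 0 by [].
rewrite -(inj_eq (mulfI four0)) !cardE !sum_colour //.
by case: xy => -> ->.
Qed.

Lemma Gamma_coherent : is_coherent X.
Proof.
split.
- exact: Gamma_classes_partition.
- exists [set diagonal V]; first by rewrite sub1set diagonal_class.
  by rewrite cover1.
(* Converse pairs have opposite signs within a copy and equal signs across the copies. *)
- move=> r /Gamma_classesP[x [y ->]]; apply/Gamma_classesP; exists y, x.
  apply/setP => [[x' y']]; rewrite inE /= !mem_colour_class !xpair_eqE.
  rewrite [side y' (+) _]addbC [side y (+) _]addbC; case: eqP => //= s_eq.
  rewrite (tsignC p_pr p_mod8 x' y') (tsignC p_pr p_mod8 x y) s_eq /twist.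
  by case: (_ (+) _); rewrite ?expr0 ?expr1; apply/eqP/eqP; lia.
- move=> ri rj rk /Gamma_classesP[a [a' ->]] /Gamma_classesP[b [b' ->]].
  move=> /Gamma_classesP[c [c' ->]].
  exists #|[set z | ((c, z) \in colour_class p (colour a a'))
                 && ((z, c') \in colour_class p (colour b b'))]| => x y.
  rewrite mem_colour_class => /eqP xy.
  under eq_finset do rewrite !mem_colour_class.
  under [in RHS]eq_finset do rewrite !mem_colour_class.
  exact: card_colour_pairs.
Qed.

End GammaCoherent.

(** * Rank, parameters and Weisfeiler-Leman closure *)

Section GammaClosure.

Variable p : nat.
Hypotheses (p_pr : prime p) (p_mod8 : (p %% 8 = 5)%N).
Local Notation V := (Gamma_vertex p).
Implicit Types (x y z : V) (u v w : szekeres_vertex p).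
Local Notation X := (Gamma_classes p).

Definition colours : seq (bool * int) :=
  [:: (false, 0); (true, 0); (false, 1); (true, 1); (false, -1); (true, -1)].

Lemma colour_in x y : colour x y \in colours.
Proof.
rewrite /colour !inE !xpair_eqE.
by case: (tsign_cases p_pr p_mod8 x y) => ->; case: (_ (+) _).
Qed.

Lemma colour_attained c : c \in colours -> exists x, exists y, colour x y = c.
Proof.
pose o : szekeres_vertex p := None; pose a : szekeres_vertex p := Some (0, false).
have s1 : szsign o a = 1 by []. have s2 : szsign a o = -1 by [].
rewrite !inE => /or4P[|||/or3P[]] /eqP ->.
- by exists (inl o), (inl o).
- by exists (inr o), (inl o).
- by exists (inl o), (inl a).
- by exists (inr o), (inl a).
- by exists (inl a), (inl o).
- by exists (inr a), (inl o).
Qed.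

Lemma card_Gamma_classes : #|X| = 6.
Proof.
have memX : X =i map (colour_class p) colours.
  move=> r; apply/Gamma_classesP/mapP => [[x [y ->]] | [c cL ->]].
    by exists (colour x y) => //; exact: colour_in.
  by have [x [y <-]] := colour_attained cL; exists x, y.
rewrite (eq_card memX); apply/card_uniqP; rewrite map_inj_in_uniq // => c d cL _ cd.
have [x [y xy]] := colour_attained cL.
have : (x, y) \in colour_class p d by rewrite -cd mem_colour_class xy.
by rewrite mem_colour_class xy => /eqP.
Qed.

Lemma Gamma_out_colours x z : (Gamma p x z)%:R =
  (colour x z == (false, 1))%:R + (colour x z == (true, 1))%:R :> int.
Proof. by rewrite GammaE_tsign // /colour !xpair_eqE; case: (_ (+) _); case: eqP. Qed.

Lemma Gamma_in_colours y z : (Gamma p y z)%:R =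
  (colour z y == (false, -1))%:R + (colour z y == (true, 1))%:R :> int.
Proof.
rewrite GammaE_tsign // (tsignC p_pr p_mod8 z y) /colour !xpair_eqE.
by case: (tsign_cases p_pr p_mod8 z y) => ->; case: (_ (+) _).
Qed.

Lemma sum_mulD4 (a b c d : V -> int) : \sum_z (a z + b z) * (c z + d z) =
  \sum_z a z * c z + \sum_z a z * d z + (\sum_z b z * c z + \sum_z b z * d z).
Proof. by rewrite -!big_split; apply: eq_bigr => z _ /=; ring. Qed.

Lemma Gamma_sqr x y :
  \sum_z (Gamma p x z)%:R * (Gamma p z y)%:R = p%:R - (Gamma p x y)%:R :> int.
Proof.
have four0 : (4 : int) != 0 by [].
apply: (mulfI four0); under eq_bigr do rewrite !Gamma_out_colours.
rewrite sum_mulD4 !mulrDr !sum_colour // GammaE_tsign //.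
by case: (tsign_cases p_pr p_mod8 x y) => ->; case: (_ (+) _);
  rewrite /sign_count /scoef_diag /scoef_sign /scoef1 /twist /=; lia.
Qed.

(** The entries of A A^T tell vertices over the same base apart from all others, as 2p differs from
    p - 1. *)
Lemma Gamma_common_out x y :
  \sum_z (Gamma p x z)%:R * (Gamma p y z)%:R =
  if base x == base y then 2 * p%:Z else p%:Z - 1 :> int.
Proof.
have four0 : (4 : int) != 0 by [].
apply: (mulfI four0).
under eq_bigr do rewrite Gamma_out_colours Gamma_in_colours.
rewrite sum_mulD4 !mulrDr !sum_colour // -tsign_eq0 //.
by case: (tsign_cases p_pr p_mod8 x y) => ->; case: (_ (+) _);
  rewrite /sign_count /scoef_diag /scoef_sign /scoef1 /twist /=; lia.
Qed.

Lemma Gamma_double x y : 2 * (Gamma p x y)%:R =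
  szsign (base x) (base y) ^+ 2 + twist (side y) * szsign (base x) (base y) :> int.
Proof.
rewrite GammaE_tsign // /tsign.
by case: (sign_cases p_pr p_mod8 (base x) (base y)) => ->; case: (side y).
Qed.

Lemma sum_szsign_sqr u : \sum_v szsign u v ^+ 2 = 2 * p%:Z.
Proof.
under eq_bigr do rewrite expr2.
by rewrite szsign_orth // eqxx mul1r addrK.
Qed.

Lemma Gamma_row x : \sum_z (Gamma p x z)%:R = 2 * p%:Z :> int.
Proof.
have two0 : (2 : int) != 0 by [].
apply: (mulfI two0); rewrite mulr_sumr; under eq_bigr do rewrite Gamma_double.
rewrite sum_Gamma_vertex !big_split /= sum_szsign_sqr -!mulr_sumr.
by rewrite /twist; ring.
Qed.

Lemma Gamma_col y : \sum_z (Gamma p z y)%:R = 2 * p%:Z :> int.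
Proof.
have two0 : (2 : int) != 0 by [].
apply: (mulfI two0); rewrite mulr_sumr; under eq_bigr do rewrite Gamma_double.
rewrite sum_Gamma_vertex !big_split /=.
under eq_bigr do rewrite szsignC // sqrrN.
rewrite -!mulr_sumr sum_szsign_sqr (_ : \sum_v szsign v (base y) = 0); first by ring.
transitivity (- \sum_v szsign (base y) v); last by rewrite sum_szsign // oppr0.
by rewrite -sumrN; apply: eq_bigr => v _; rewrite szsignC.
Qed.

Lemma Gamma_dsrg : is_dsrg (Gamma p) (4 * p + 2) (2 * p) p (p - 1) p.
Proof.
have p_gt0 := prime_gt0 p_pr.
have mxfunJ x y : mxfun (const_mx 1 : 'M[int]_#|V|) x y = 1 by rewrite /mxfun mxE.
split.
- by move=> x; rewrite GammaE_tsign // /tsign szsign_diag // mulr0.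
- by rewrite card_sum !card_szekeres_vertex //; lia.
- split; apply: mxfunP => x y; rewrite mxfunM.
    under eq_bigr do rewrite mxfun_adjmx mxfunJ mulr1.
    by rewrite Gamma_row /mxfun !mxE mulr1 natrM [p%:R]natz.
  under eq_bigr do rewrite mxfun_adjmx mxfunJ mul1r.
  by rewrite Gamma_col /mxfun !mxE mulr1 natrM [p%:R]natz.
apply: mxfunP => x y; rewrite mxfunM.
under eq_bigr do rewrite !mxfun_adjmx.
rewrite Gamma_sqr /mxfun !mxE !enum_rankK natrB // (inj_eq enum_rank_inj).
by case: (x == y); case: (Gamma p x y); rewrite ?mulr1n ?mulr0n; ring.
Qed.

(** Recovers the colour from data that every coherent configuration containing the arcs determines,
    and that every automorphism preserves; it serves both [Gamma_WL_closure] and [colour_aut]. *)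
Definition colour_of (out_xy out_yx eq_xy : bool) (common : int) : bool * int :=
  if common == 2 * p%:Z then (~~ eq_xy, 0)
  else (out_xy == out_yx, if out_xy then 1 else -1).

Lemma colourE x y : colour x y =
  colour_of (Gamma p x y) (Gamma p y x) (x == y)
    (\sum_z (Gamma p x z)%:R * (Gamma p y z)%:R).
Proof.
have p_gt0 := prime_gt0 p_pr.
rewrite /colour_of Gamma_common_out vertex_eq !GammaE_tsign //.
rewrite (tsignC p_pr p_mod8 x y) -tsign_eq0 // /colour.
case: (tsign_cases p_pr p_mod8 x y) => -> /=.
- by rewrite eqxx andbT; case: (side x); case: (side y).
- by rewrite ifF; [case: (_ (+) _) | lia].
by rewrite ifF; [case: (_ (+) _) | lia].
Qed.

Lemma Gamma_constant : class_constant X (Gamma p).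
Proof.
by apply: Gamma_class_constant => x y x' y'; rewrite !GammaE_tsign // => - [_ ->].
Qed.

Lemma Gamma_WL_closure (R : realType) : is_WL_closure R (Gamma p) X.
Proof.
have pX := Gamma_classes_partition p.
split; first exact: Gamma_coherent.
  by apply/(adj_span_adjmx _ _ pX)/Gamma_constant.
move=> Y cohY; have [pY _ _ _] := cohY.
move/(adj_span_adjmx _ _ pY) => out_Y; apply: coarserP => // r.
move=> /Gamma_classesP[a [b ->]] s sY x y x' y' h h'; rewrite !mem_colour_class.
congr (_ == _); rewrite !colourE.
have in_Y := class_constant_converse cohY out_Y.
(* Common out-neighbours are counted by A A^T, a product of two matrices constant on the classes of
   [Y]. *)
have num_Y := class_constant_comp (fun c : bool => c%:R : int) out_Y.
have num_Y' := class_constant_comp (fun c : bool => c%:R : int) in_Y.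
rewrite (out_Y s sY x y x' y') // (in_Y s sY x y x' y') //.
rewrite (class_constant_diag cohY sY h h').
by rewrite (class_constant_mul cohY num_Y num_Y' sY h h').
Qed.

End GammaClosure.

(** * Automorphisms of Gamma and the non-Schurian property *)

Section GammaAutomorphisms.

Variable p : nat.
Hypotheses (p_pr : prime p) (p_mod8 : (p %% 8 = 5)%N) (p_ge13 : (13 <= p)%N).
Local Notation V := (Gamma_vertex p).
Implicit Types (x y z : V) (u v w : szekeres_vertex p).
Local Notation X := (Gamma_classes p).

Lemma colour_aut (g : {perm V}) x y :
  g \in digraph_aut (Gamma p) -> colour (g x) (g y) = colour x y.
Proof.
rewrite inE => /forallP gP.
have gE a b : Gamma p (g a) (g b) = Gamma p a b by apply/eqP/(forallP (gP a)).
rewrite !colourE // !gE (inj_eq perm_inj); congr colour_of.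
rewrite (reindex_inj (@perm_inj _ g)); apply: eq_bigr => z _.
by rewrite !gE.
Qed.

Lemma Gamma_aut_infty (g : {perm V}) :
  g \in digraph_aut (Gamma p) -> g (inl None) <> inl (Some (0, false)).
Proof.
move=> gA g_infty; pose phi u := base (g (inl u)).
have gE u : g (inl u) = inl (phi u).
  (* Automorphisms preserve whether two vertices lie in the same copy; as the image of infinity
     stays in the first copy, [g] restricts to an automorphism of the tournament there. *)
  have [/addbP side_eq _] := colour_aut (inl u) (inl None) gA.
  move: side_eq; rewrite g_infty /phi /=.
  by case: (g (inl u)).
apply: (@szekeres_intransitive p p_pr p_mod8 p_ge13 phi).
- move=> u v uv; apply: (@inl_inj _ (szekeres_vertex p)).
  by apply: (@perm_inj _ g); rewrite !gE uv.
- move=> u v; move: gA; rewrite inE => /forallP/(_ (inl u))/forallP/(_ (inl v)).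
  by rewrite !gE => /eqP.
- by rewrite /phi g_infty.
Qed.

Lemma Gamma_intransitive : intransitive (Gamma p).
Proof.
move=> trans; have [g gA gE] :=
  atransP2 trans (in_setT (inl None)) (in_setT (inl (Some (0, false)))).
by apply: (Gamma_aut_infty gA); rewrite gE.
Qed.

(** A group whose orbits on pairs are the classes preserves the arcs, a union of classes, and is
    transitive, since the diagonal is a single class. [Gamma_aut_infty] excludes this. *)
Lemma Gamma_not_schurian : ~ is_schurian X.
Proof.
move=> [G XE].
have G_aut (g : {perm V}) : g \in G -> g \in digraph_aut (Gamma p).
  move=> gG; rewrite inE; apply/forallP => x; apply/forallP => y; apply/eqP.
  pose r := [set ((h : {perm V}) x, (h : {perm V}) y) | h in G].
  have rX : r \in X by rewrite XE; apply/imsetP; exists (x, y).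
  have /Gamma_classesP[a [b rE]] := rX.
  have gxy : (g x, g y) \in r by apply/imsetP; exists g.
  have xy : (x, y) \in r by apply/imsetP; exists 1%g; rewrite ?group1 ?perm1.
  move: gxy xy; rewrite rE !mem_colour_class => /eqP <- /eqP [_ ts].
  by rewrite !GammaE_tsign // ts.
have [[a b] _ diagE] : exists2 xy : V * V, xy \in predT &
    diagonal V = [set ((g : {perm V}) xy.1, (g : {perm V}) xy.2) | g in G].
  by apply/imsetP; rewrite -XE diagonal_class.
have orbit_a x : exists2 g, g \in G & x = g a.
  have : (x, x) \in diagonal V by rewrite inE.
  by rewrite diagE => /imsetP[g gG [-> _]]; exists g.
have [g gG ga] := orbit_a (inl None); have [h hG ha] := orbit_a (inl (Some (0, false))).
apply: (@Gamma_aut_infty (g^-1 * h)%g); first by rewrite G_aut // groupM ?groupV.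
by rewrite permM ga permK ha.
Qed.

Lemma Gamma_scheme : is_association_scheme X.
Proof. by split; [exact: Gamma_coherent | exact: diagonal_class]. Qed.

Lemma Gamma_noncommutative (R : realType) : noncommutative R X.
Proof.
have p_gt0 := prime_gt0 p_pr.
have proper : is_proper_dsrg (Gamma p) (4 * p + 2) (2 * p) p (p - 1) p.
  by split; [exact: Gamma_dsrg | lia].
by have [] := proper_dsrg_scheme R proper Gamma_scheme (Gamma_constant p_pr p_mod8).
Qed.

Lemma card_Gamma_vertex : #|V| = (4 * p + 2)%N.
Proof. by have [] := Gamma_dsrg p_pr p_mod8. Qed.

End GammaAutomorphisms.

Local Close Scope ring_scope.

Theorem theorem3p8 (R : realType) :
  (forall p : nat, szekeres_prime p ->
     [/\ is_dsrg (Gamma p) (4 * p + 2) (2 * p) p (p - 1) p,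
         intransitive (Gamma p)
       & exists X : {set {set Gamma_vertex p * Gamma_vertex p}},
           [/\ is_WL_closure R (Gamma p) X,
               is_association_scheme X,
               noncommutative R X,
               #|X| = 6
             & ~ is_schurian X]])
  /\ ((forall N : nat, exists2 p : nat, N < p & szekeres_prime p)
      /\ (forall p q : nat, szekeres_prime p -> szekeres_prime q -> p <> q ->
            ~ digraph_isomorphic (Gamma p) (Gamma q)))
  /\ (forall (V : finType) (e : rel V) (v k t lam mu : nat)
             (X S : {set {set V * V}}),
        is_proper_dsrg e v k t lam mu ->
        is_association_scheme X ->
        S \subset X -> arcs e = cover S ->
        noncommutative R X /\ 6 <= #|X|).
Proof.
split; [move=> p [p_pr p_mod8 p_ge13] | split; [split |]].
- split; first exact: Gamma_dsrg.
    exact: Gamma_intransitive.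
  exists (Gamma_classes p); split.
  + exact: Gamma_WL_closure.
  + exact: Gamma_scheme.
  + exact: Gamma_noncommutative.
  + exact: card_Gamma_classes.
  + exact: Gamma_not_schurian.
- exact: szekeres_primes_infinite.
(* The orders 4p + 2 and 4q + 2 differ. *)
- move=> p q [p_pr p8 _] [q_pr q8 _] pq [h h_bij _]; apply: pq.
  by have := bij_eq_card h_bij; rewrite !card_Gamma_vertex //; lia.
- move=> V e v k t lam mu X S dsrg scheme SX eS.
  apply: (proper_dsrg_scheme R dsrg scheme).
  by have [[pX _ _ _] _] := scheme; exact: class_constant_cover pX SX eS.
Qed.
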